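(* Let $A$ be an abelian variety of dimension $g$. (1) Suppose $g \geq 5$. Then $\rho(A) = (g-1)^2+1$ if and only if $A$ is isogenous to $E_1^{g-1} \times E_2$ for some elliptic curves $E_1, E_2$ such that $E_1$ has complex multiplication and $E_1$ and $E_2$ are not isogenous. (2) Suppose $g \geq 7$. Then $\rho(A) = (g-2)^2+4$ if and only if $A$ is isogenous to $E_1^{g-2} \times E_2^2$ for some elliptic curves $E_1, E_2$ which both have complex multiplication and are not isogenous to each other.
   Context: Abelian varieties (in particular elliptic curves) are over the field $\mathbb{C}$ of complex numbers. The Picard number $\rho(A)$ of an abelian variety $A$ is the rank of its Néron–Severi group $\operatorname{NS}(A)$. *)

(* Defs.v *)
(* Complex abelian varieties, in the analytic model: A = V / Lambda where
   V = C^g (row vectors over C = R[i]), Lambda is a lattice in V, and there is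
   a polarization, i.e. a positive definite Hermitian form on V whose imaginary
   part is integral on Lambda.  R is an arbitrary model of the real numbers.   *)
From HB Require Import structures.
From mathcomp Require Import all_boot all_order all_algebra.
From mathcomp Require Import complex.
From mathcomp Require Import boolp classical_sets reals.
Set Implicit Arguments. Unset Strict Implicit. Unset Printing Implicit Defensive.
Import Order.TTheory GRing.Theory Num.Theory.
Local Open Scope ring_scope.
Local Open Scope classical_set_scope.
Local Open Scope complex_scope.

Definition Zfree (V : zmodType) (n : nat) (x : 'I_n -> V) : Prop :=
  forall z : 'I_n -> int, \sum_i x i *~ z i = 0 -> forall i, z i = 0.

(* The rank of a subgroup S of V is the largest size of a Z-linearly
   independent family in S; the value 0 is also used if S has infinite rank.   *)
Definition has_Zrank (V : zmodType) (S : set V) (n : nat) : Prop :=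
  (exists x : 'I_n -> V, (forall i, S (x i)) /\ Zfree x) /\
  ~ (exists x : 'I_n.+1 -> V, (forall i, S (x i)) /\ Zfree x).

Definition Zrank (V : zmodType) (S : set V) : nat := xget 0%N (has_Zrank S).

Lemma Zfree_widen (V : zmodType) (m n : nat) (lemn : (m <= n)%N)
    (x : 'I_n -> V) : Zfree x -> Zfree (x \o widen_ord lemn).
Proof.
move=> fx z z0 i.
pose z' (j : 'I_n) := if insub (j : nat) is Some k then z k else 0 : int.
have z'E k : z' (widen_ord lemn k) = z k.
  by rewrite /z' /= valK.
rewrite -z'E; apply: fx; rewrite -[RHS]z0.
rewrite (bigID (fun j : 'I_n => (j < m)%N)) /= [X in _ + X]big1 ?addr0; last first.
  by move=> j /negbTE ge; rewrite /z' insubF // mulr0z.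
have -> : \sum_(j < n | (j < m)%N) x j *~ z' j
        = \sum_(j < n | (j < m)%N) \sum_(k < m | widen_ord lemn k == j) x j *~ z' j.
  by apply: eq_bigr => j lt; rewrite (big_pred1 (Ordinal lt)).
rewrite (exchange_big_dep xpredT) //=; apply: eq_bigr => k _.
rewrite (big_pred1 (widen_ord lemn k)) ?z'E // => j /=.
by rewrite [RHS]eq_sym andbC; case: eqP => //= <-; rewrite /= ltn_ord.
Qed.

Lemma ZrankP (V : zmodType) (S : set V) (n : nat) :
  has_Zrank S n -> Zrank S = n.
Proof.
move=> hn; apply: xget_unique => // m hm.
have aux p q : has_Zrank S p -> has_Zrank S q -> (q <= p)%N.
  case=> _ no [] [x [Sx fx]] _; rewrite leqNgt; apply/negP => lt; apply: no.
  exists (x \o widen_ord lt); split; first by move=> i; apply: Sx.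
  exact: Zfree_widen.
by apply/eqP; rewrite eqn_leq !aux.
Qed.

Section AbelianVarieties.
Variable R : realType.
Local Notation C := R[i].

(* L is the Z-span of a basis of C^g over the reals (so #|I| = 2g). *)
Definition is_lattice g (L : set 'rV[C]_g) : Prop :=
  exists (I : finType) (b : I -> 'rV[C]_g),
    (forall v, exists! x : {ffun I -> R}, v = \sum_i (x i)%:C *: b i) /\
    L = [set v | exists z : I -> int, v = \sum_i b i *~ z i].

(* The Neron-Severi group of the torus C^g / L.  By Appell-Humbert (or the
   Lefschetz (1,1) theorem), taking first Chern classes identifies it with the
   group of Hermitian forms on C^g whose imaginary part is integral on L; a
   Hermitian matrix H stands for the form (u, v) |-> u H v^*.                  *)
Definition NS_of g (L : set 'rV[C]_g) : set 'M[C]_g :=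
  [set H | H \is hermsymmx /\
    forall u v, L u -> L v -> complex.Im (form Num.conj H u v) \is a Num.int].

Definition positive_definite g (H : 'M[C]_g) : Prop :=
  forall u, u != 0 -> 0 < form Num.conj H u u.

Record abelianVariety (g : nat) := AbelianVariety {
  lattice : set 'rV[C]_g;
  latticeP : is_lattice lattice;
  polarizable : exists H, NS_of lattice H /\ positive_definite H }.

Definition NS g (A : abelianVariety g) : set 'M[C]_g := NS_of (lattice A).

Definition picard_number g (A : abelianVariety g) : nat := Zrank (NS A).

(* A homomorphism A -> B is given by its analytic representation, the C-linear
   map v |-> v M between the universal covers.                                 *)
Definition is_hom g h (A : abelianVariety g) (B : abelianVariety h)
    (M : 'M[C]_(g, h)) : Prop :=
  forall v, lattice A v -> lattice B (v *m M).

Definition hom_surjective g h (B : abelianVariety h) (M : 'M[C]_(g, h)) : Prop :=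
  forall w, exists v, lattice B (w - v *m M).

(* The kernel is {v | v M \in lattice B} / lattice A; the sequence lists representatives. *)
Definition hom_finite_kernel g h (A : abelianVariety g) (B : abelianVariety h)
    (M : 'M[C]_(g, h)) : Prop :=
  exists s : seq 'rV[C]_g,
    forall v, lattice B (v *m M) -> exists2 k, k \in s & lattice A (v - k).

Definition is_isogeny g h (A : abelianVariety g) (B : abelianVariety h)
    (M : 'M[C]_(g, h)) : Prop :=
  [/\ is_hom A B M, hom_surjective B M & hom_finite_kernel A B M].

Definition isogenous g h (A : abelianVariety g) (B : abelianVariety h) : Prop :=
  exists M, is_isogeny A B M.

Definition ellipticCurve := abelianVariety 1.

(* End(E) is strictly larger than Z. *)
Definition has_CM (E : ellipticCurve) : Prop :=
  exists M : 'M[C]_1, is_hom E E M /\ forall n : int, M <> (n%:~R)%:M.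

Lemma lattice0 g (A : abelianVariety g) : lattice A 0.
Proof.
have [I [b [_ ->]]] := latticeP A; exists (fun=> 0).
by rewrite big1 // => i _; rewrite mulr0z.
Qed.

Lemma latticeB g (A : abelianVariety g) u v :
  lattice A u -> lattice A v -> lattice A (u - v).
Proof.
have [I [b [_ ->]]] := latticeP A => -[z ->] [t ->].
exists (fun i => z i - t i); rewrite -sumrB.
by apply: eq_bigr => i _; rewrite mulrzBr.
Qed.

Lemma NS0 g (A : abelianVariety g) : NS A 0.
Proof.
split; first by apply/is_hermitianmxP; rewrite raddf0 map_mx0 scaler0.
by move=> u v _ _; rewrite /form mulmx0 mul0mx mxE; apply: rpred0.
Qed.

Lemma NSB g (A : abelianVariety g) H K : NS A H -> NS A K -> NS A (H - K).
Proof.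
move=> [/is_hermitianmxP hH iH] [/is_hermitianmxP hK iK]; split.
  apply/is_hermitianmxP; rewrite raddfB map_mxB scalerBr -hH -hK //.
move=> u v Au Av; rewrite /form mulmxBr mulmxBl !mxE.
have -> (x y : C) : complex.Im (x - y) = complex.Im x - complex.Im y.
  by case: x => ? ?; case: y.
by apply: rpredB; [have := iH u v Au Av | have := iK u v Au Av];
  rewrite /form mxE.
Qed.

Lemma isogenous_refl g (A : abelianVariety g) : isogenous A A.
Proof.
exists 1%:M; split; first by move=> v; rewrite mulmx1.
  by move=> w; exists w; rewrite mulmx1 subrr; apply: lattice0.
exists [:: 0] => v; rewrite mulmx1 => Av.
by exists 0; rewrite ?mem_seq1 ?subr0.
Qed.

Definition point_lattice : set 'rV[C]_0 := setT.

Fact point_latticeP : is_lattice point_lattice.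
Proof.
exists 'I_0, (fun=> 0); split.
  move=> v; exists [ffun=> 0]; split; first by rewrite thinmx0 [RHS]thinmx0.
  by move=> x _; apply/ffunP => -[].
apply/seteqP; split=> v // _; exists (fun=> 0).
by rewrite thinmx0 [RHS]thinmx0.
Qed.

Fact point_polarizable :
  exists H, NS_of point_lattice H /\ positive_definite H.
Proof.
exists 0; split; last by move=> u; rewrite thinmx0 eqxx.
split; first by apply/is_hermitianmxP; rewrite raddf0 map_mx0 scaler0.
by move=> u v _ _; rewrite /form mulmx0 mul0mx mxE; apply: rpred0.
Qed.

Definition point : abelianVariety 0 :=
  AbelianVariety point_latticeP point_polarizable.

Section Product.
Variables (g h : nat) (A : abelianVariety g) (B : abelianVariety h).

Definition prod_lattice : set 'rV[C]_(g + h) :=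
  [set v | lattice A (lsubmx v) /\ lattice B (rsubmx v)].

Fact prod_latticeP : is_lattice prod_lattice.
Proof.
have [I [b [bP AE]]] := latticeP A; have [J [c [cP BE]]] := latticeP B.
pose d (k : I + J) : 'rV[C]_(g + h) :=
  match k with inl i => row_mx (b i) 0 | inr j => row_mx 0 (c j) end.
exists (I + J)%type, d; split.
  have dE (x : {ffun I + J -> R}) : \sum_k (x k)%:C *: d k =
      row_mx (\sum_i (x (inl i))%:C *: b i) (\sum_j (x (inr j))%:C *: c j).
    rewrite big_sumType /=.
    have -> : \sum_i (x (inl i))%:C *: row_mx (b i) (0 : 'rV[C]_h) =
              row_mx (\sum_i (x (inl i))%:C *: b i) 0.
      elim/big_rec2: _ => [|i y1 y2 _ ->]; first by rewrite row_mx0.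
      by rewrite scale_row_mx scaler0 add_row_mx addr0.
    have -> : \sum_j (x (inr j))%:C *: row_mx (0 : 'rV[C]_g) (c j) =
              row_mx 0 (\sum_j (x (inr j))%:C *: c j).
      elim/big_rec2: _ => [|i y1 y2 _ ->]; first by rewrite row_mx0.
      by rewrite scale_row_mx scaler0 add_row_mx addr0.
    by rewrite add_row_mx addr0 add0r.
  move=> v; have [x [xE xU]] := bP (lsubmx v).
  have [y [yE yU]] := cP (rsubmx v).
  exists [ffun k => match k with inl i => x i | inr j => y j end]; split.
    rewrite dE -[LHS]hsubmxK xE yE; congr row_mx; apply: eq_bigr => k _;
      by rewrite ffunE.
  move=> t; rewrite dE -[LHS]hsubmxK => /eq_row_mx [tx ty].
  have ex : x = [ffun i => t (inl i)].
    by apply: xU; rewrite tx; apply: eq_bigr => k _; rewrite ffunE.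
  have ey : y = [ffun j => t (inr j)].
    by apply: yU; rewrite ty; apply: eq_bigr => k _; rewrite ffunE.
  by apply/ffunP => -[i|j]; rewrite ffunE ?ex ?ey ffunE.
have dE (z : I + J -> int) : \sum_k d k *~ z k =
    row_mx (\sum_i b i *~ z (inl i)) (\sum_j c j *~ z (inr j)).
  rewrite big_sumType /=.
  have rz m n (u : 'rV[C]_m) (v : 'rV[C]_n) (k : int) :
      row_mx u v *~ k = row_mx (u *~ k) (v *~ k).
    by rewrite -(scaler_int (R := C)) scale_row_mx !(scaler_int (R := C)).
  have -> : \sum_i row_mx (b i) (0 : 'rV[C]_h) *~ z (inl i) =
            row_mx (\sum_i b i *~ z (inl i)) 0.
    elim/big_rec2: _ => [|i y1 y2 _ ->]; first by rewrite row_mx0.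
    by rewrite rz mul0rz add_row_mx addr0.
  have -> : \sum_j row_mx (0 : 'rV[C]_g) (c j) *~ z (inr j) =
            row_mx 0 (\sum_j c j *~ z (inr j)).
    elim/big_rec2: _ => [|i y1 y2 _ ->]; first by rewrite row_mx0.
    by rewrite rz mul0rz add_row_mx addr0.
  by rewrite add_row_mx addr0 add0r.
apply/seteqP; split=> v /=.
  rewrite /prod_lattice /= AE BE => -[[x xE] [y yE]].
  exists (fun k => match k with inl i => x i | inr j => y j end).
  by rewrite dE -xE -yE hsubmxK.
case=> z ->; rewrite dE /prod_lattice /= row_mxKl row_mxKr AE BE.
by split; [exists (z \o inl) | exists (z \o inr)].
Qed.

Fact prod_polarizable :
  exists H, NS_of prod_lattice H /\ positive_definite H.
Proof.
have [H [[/is_hermitianmxP hH iH] pH]] := polarizable A.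
have [K [[/is_hermitianmxP hK iK] pK]] := polarizable B.
have fE (u v : 'rV[C]_(g + h)) : form Num.conj (block_mx H 0 0 K) u v =
    form Num.conj H (lsubmx u) (lsubmx v) + form Num.conj K (rsubmx u) (rsubmx v).
  rewrite /form -[in LHS](hsubmxK u) -[in LHS](hsubmxK v).
  rewrite mul_row_block !mulmx0 addr0 add0r tr_row_mx map_col_mx mul_row_col.
  by rewrite !mxE.
exists (block_mx H 0 0 K); split; first split.
- apply/is_hermitianmxP; rewrite expr0 scale1r.
  rewrite expr0 scale1r in hH; rewrite expr0 scale1r in hK.
  by rewrite tr_block_mx map_block_mx !trmx0 !map_mx0 -hH -hK.
- move=> u v [Au Bu] [Av Bv]; rewrite fE.
  have -> (x y : C) : complex.Im (x + y) = complex.Im x + complex.Im y.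
    by case: x => ? ?; case: y.
  by apply: rpredD; [apply: iH | apply: iK].
move=> u u0; rewrite fE.
have [l0|l0] := eqVneq (lsubmx u) 0.
  rewrite l0 form0l add0r; apply: pK; apply: contraNneq u0 => r0.
  by rewrite -[u]hsubmxK l0 r0 row_mx0.
apply: ltr_pwDl; first exact: pH.
have [->|r0] := eqVneq (rsubmx u) 0; first by rewrite form0l.
exact/ltW/pK.
Qed.

Definition prodAV : abelianVariety (g + h) :=
  AbelianVariety prod_latticeP prod_polarizable.

End Product.

Fixpoint powAV g (A : abelianVariety g) (n : nat) : abelianVariety (n * g) :=
  match n with
  | 0 => point
  | n'.+1 => prodAV A (powAV A n')
  end.

End AbelianVarieties.

(* Main.v *)
(* A polarized abelian variety C^g / L is encoded by the real matrix J of the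
   multiplication by i in a basis of L.  Homomorphisms up to isogeny are then the
   rational matrices T with J T = T J', and NS (x) Q is the space of rational
   antisymmetric matrices E with J E J^T = E.

   Write rho for the Picard number and hom(B, A) for the rank of Hom(B, A).  A
   polarization gives Poincare reducibility and
   rho(B x A') = rho(B) + rho(A') + hom(B, A').
   - If B is simple of dimension d, nonzero elements of NS(B) are nondegenerate,
     so E is determined by its first row, whose first entry is 0:
     rho(B) <= 2d - 1.  Likewise hom(B, A') <= 2 dim A'.
   - If E is an elliptic curve without complex multiplication,
     hom(E, A) <= dim A: for a basis (w1, w2) of the lattice of E, the maps
     T |-> T w1 and T |-> T w2 embed Hom(E, A) as two subspaces of L_A (x) Q,
     and a common nonzero vector would yield a non-scalar endomorphism of E.
   Peeling off simple factors gives rho(A) <= g^2 always, and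
   rho(A) <= g (g + 1) / 2 if A contains no elliptic curve with complex
   multiplication.  Otherwise A ~ E^k x A' with E a CM curve, k > 0, and
   Hom(E, A') = 0, so that rho(A) = k^2 + rho(A') with rho(A') <= (g - k)^2, and
   the theorem follows by comparing squares. *)
Require Import Defs.
From HB Require Import structures.
From mathcomp Require Import all_boot all_order all_algebra.
From mathcomp Require Import complex.
From mathcomp Require Import boolp classical_sets reals.
From mathcomp Require Import zify ring lra.
Set Implicit Arguments. Unset Strict Implicit. Unset Printing Implicit Defensive.
Import Order.TTheory GRing.Theory Num.Theory.
Local Open Scope ring_scope.

(** * Dimensions of subspaces given by predicates *)

Section SubspaceDimension.
Variable K : fieldType.

Definition subspace_pred (V : vectType K) (P : V -> Prop) : Prop :=
  P 0 /\ forall a u v, P u -> P v -> P (a *: u + v).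

(** The predicates of interest constrain rational matrices by equations over the reals, so the
    subspace is obtained by classical choice. The default 0 is not reached once [subspace_pred P]
    holds. *)
Definition vspace_of (V : vectType K) (P : V -> Prop) : {vspace V} :=
  xget 0%VS [set W : {vspace V} | forall u, (u \in W) <-> P u]%classic.

Definition qdim (V : vectType K) (P : V -> Prop) : nat := \dim (vspace_of P).

Lemma subspace_predZ (V : vectType K) (P : V -> Prop) a u :
  subspace_pred P -> P u -> P (a *: u).
Proof. by move=> [P0 PD] Pu; rewrite -[_ *: _]addr0; apply: PD. Qed.

(** Among the subspaces contained in [P], one of maximal dimension is all of [P]: adjoining the line
    of a missing vector would give a larger one. *)
Lemma vspace_ofP (V : vectType K) (P : V -> Prop) :
  subspace_pred P -> forall u, (u \in vspace_of P) <-> P u.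
Proof.
move=> [P0 PD].
pose Q n := `[< exists W : {vspace V}, \dim W = n /\ forall u, u \in W -> P u >].
have Q0 : exists n, Q n.
  exists 0%N; apply/asboolP; exists 0%VS; rewrite dimv0; split=> // u.
  by rewrite memv0 => /eqP ->.
have Qub n : Q n -> (n <= \dim {:V})%N.
  by move=> /asboolP [W [<- _]]; apply/dimvS/subvf.
have [n /asboolP [W [dW WP]] maxn] := ex_maxnP Q0 Qub.
suff h : exists W : {vspace V}, forall u, (u \in W) <-> P u.
  by have [W' hW'] := h; rewrite /vspace_of; case: xgetP => [? _ //|/(_ W')].
exists W => u; split; first exact: WP.
move=> Pu; apply/negPn/negP => uW.
have /maxn : Q (\dim (W + <[u]>)%VS).
  apply/asboolP; exists (W + <[u]>)%VS; split=> // v.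
  by move=> /memv_addP [w wW [_ /vlineP [a ->] ->]]; rewrite addrC; apply: PD => //; apply: WP.
rewrite leqNgt -dW => /negP; apply.
rewrite ltnNge; apply: contra uW => le.
have /eqP -> : W == (W + <[u]>)%VS by rewrite eqEdim addvSl.
by rewrite memvE addvSr.
Qed.

Let lin (V V' : vectType K) (f : V -> V') : linear f -> exists F : 'Hom(V, V'), F =1 f.
Proof.
move=> lf.
pose F : {linear V -> V'} := HB.pack f (GRing.isLinear.Build K V V' _ f lf).
by exists (linfun F) => u; rewrite lfunE.
Qed.

(** Rank-nullity for predicates: [f] maps [P] onto [P1], and [h] identifies [P2] with the kernel of
    [f] on [P]. *)
Lemma qdim_split (V V1 V2 : vectType K) (P : V -> Prop) (P1 : V1 -> Prop)
    (P2 : V2 -> Prop) (f : V -> V1) (h : V2 -> V) :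
  subspace_pred P -> subspace_pred P1 -> subspace_pred P2 ->
  linear f -> linear h ->
  (forall u, P u -> P1 (f u)) ->
  (forall w, P1 w -> exists2 u, P u & f u = w) ->
  (forall w, P2 w -> P (h w) /\ f (h w) = 0) ->
  (forall w, h w = 0 -> w = 0) ->
  (forall u, P u -> f u = 0 -> exists2 w, P2 w & h w = u) ->
  qdim P = (qdim P1 + qdim P2)%N.
Proof.
move=> sP sP1 sP2 /lin [F FE] /lin [H HE] fP fsurj hP hinj hker.
rewrite /qdim -(limg_ker_dim F) addnC; congr (_ + _)%N.
  congr (\dim _); apply/vspaceP => w; apply/idP/idP.
    by move=> /memv_imgP [u /(vspace_ofP sP) Pu ->]; rewrite FE; apply/(vspace_ofP sP1)/fP.
  move=> /(vspace_ofP sP1) /fsurj [u Pu <-]; rewrite -FE; apply: memv_img.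
  exact/(vspace_ofP sP).
rewrite -(@limg_dim_eq _ _ _ H (vspace_of P2)); last first.
  apply/eqP; rewrite -subv0; apply/subvP => w; rewrite memv_cap memv_ker HE.
  by move=> /andP [_ /eqP /hinj ->]; rewrite mem0v.
congr (\dim _); apply/vspaceP => u; apply/idP/idP.
  rewrite memv_cap memv_ker FE => /andP [/(vspace_ofP sP) Pu /eqP fu].
  by have [w Pw <-] := hker _ Pu fu; rewrite -HE memv_img //; apply/(vspace_ofP sP2).
move=> /memv_imgP [w /(vspace_ofP sP2) Pw ->]; rewrite HE memv_cap memv_ker FE.
by have [Ph ->] := hP _ Pw; rewrite eqxx andbT; apply/(vspace_ofP sP).
Qed.

Lemma qdim_le (V V' : vectType K) (P : V -> Prop) (P' : V' -> Prop) (f : V -> V') :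
  subspace_pred P -> subspace_pred P' -> linear f ->
  (forall u, P u -> P' (f u)) -> (forall u, P u -> f u = 0 -> u = 0) ->
  (qdim P <= qdim P')%N.
Proof.
move=> sP sP' /lin [F FE] fP finj; rewrite /qdim -(@limg_dim_eq _ _ _ F (vspace_of P)).
  apply/dimvS/subvP => _ /memv_imgP [u /(vspace_ofP sP) Pu ->].
  by rewrite FE; apply/(vspace_ofP sP')/fP.
apply/eqP; rewrite -subv0; apply/subvP => u; rewrite memv_cap memv_ker FE.
by move=> /andP [/(vspace_ofP sP) Pu /eqP /(finj _ Pu) ->]; rewrite mem0v.
Qed.

Lemma subspace_predT (V : vectType K) : subspace_pred (fun _ : V => True).
Proof. by []. Qed.

Lemma qdimT (V : vectType K) : qdim (fun _ : V => True) = \dim {:V}.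
Proof.
rewrite /qdim; congr (\dim _); apply/vspaceP => u; rewrite memvf.
by apply/idP/(vspace_ofP (@subspace_predT V)).
Qed.

Lemma dim_rV n : \dim {: 'rV[K]_n} = n.
Proof. rewrite dimvf dim_matrix; exact: mul1n. Qed.

(** Serves for homomorphisms from a curve without complex multiplication, where [f1] and [f2] are
    two row evaluations on the same space. Their images are independent in [V], so the dimensions
    add up. *)
Lemma qdim_disjoint (V V1 V2 : vectType K) (P1 : V1 -> Prop) (P2 : V2 -> Prop)
    (f1 : V1 -> V) (f2 : V2 -> V) :
  subspace_pred P1 -> subspace_pred P2 -> linear f1 -> linear f2 ->
  (forall u, P1 u -> f1 u = 0 -> u = 0) -> (forall u, P2 u -> f2 u = 0 -> u = 0) ->
  (forall u v, P1 u -> P2 v -> f1 u = f2 v -> f1 u = 0) ->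
  (qdim P1 + qdim P2 <= \dim {:V})%N.
Proof.
move=> sP1 sP2 /lin [F1 E1] /lin [F2 E2] i1 i2 d12.
rewrite /qdim -(@limg_dim_eq _ _ _ F1 (vspace_of P1)); last first.
  apply/eqP; rewrite -subv0; apply/subvP => u; rewrite memv_cap memv_ker E1.
  by move=> /andP [/(vspace_ofP sP1) Pu /eqP /(i1 _ Pu) ->]; rewrite mem0v.
rewrite -(@limg_dim_eq _ _ _ F2 (vspace_of P2)); last first.
  apply/eqP; rewrite -subv0; apply/subvP => u; rewrite memv_cap memv_ker E2.
  by move=> /andP [/(vspace_ofP sP2) Pu /eqP /(i2 _ Pu) ->]; rewrite mem0v.
rewrite -dimv_disjoint_sum ?dimvS ?subvf //.
apply/eqP; rewrite -subv0; apply/subvP => u; rewrite memv_cap.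
move=> /andP [/memv_imgP [w /(vspace_ofP sP1) Pw ->]].
move=> /memv_imgP [z /(vspace_ofP sP2) Pz]; rewrite E1 E2 => /d12 -> //.
exact: mem0v.
Qed.

Lemma qdim_ge2 (V : vectType K) (P : V -> Prop) u v :
  subspace_pred P -> P u -> P v -> u != 0 -> (forall a, v <> a *: u) ->
  (2 <= qdim P)%N.
Proof.
move=> sP Pu Pv u0 vu.
have -> : 2%N = \dim (<[u]> + <[v]>)%VS.
  rewrite dimv_disjoint_sum ?dim_vline ?u0 //.
    case: eqVneq => // v0; case: (vu 0); by rewrite scale0r.
  apply/eqP; rewrite -subv0; apply/subvP => w; rewrite memv_cap.
  move=> /andP [/vlineP [a ->] /vlineP [b]].
  have [->|b0] := eqVneq b 0; first by rewrite scale0r => ->; rewrite mem0v.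
  move=> ab; case: (vu (b^-1 * a)); by rewrite -scalerA ab scalerA mulVf ?scale1r.
apply: dimvS; apply/subvP => w /memv_addP [x /vlineP [a ->] [y /vlineP [b ->] ->]].
by apply/(vspace_ofP sP); case: (sP) => _; apply=> //; apply: subspace_predZ.
Qed.

Lemma qdim0 (V : vectType K) (P : V -> Prop) :
  subspace_pred P -> (forall u, P u -> u = 0) -> qdim P = 0%N.
Proof.
move=> sP P0; apply/eqP; rewrite /qdim dimv_eq0 -subv0; apply/subvP => u.
by move=> /(vspace_ofP sP) /P0 ->; rewrite mem0v.
Qed.

Lemma qdim_eq0 (V : vectType K) (P : V -> Prop) :
  subspace_pred P -> qdim P = 0%N -> forall u, P u -> u = 0.
Proof.
move=> sP /eqP; rewrite /qdim dimv_eq0 => /eqP e u /(vspace_ofP sP).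
by rewrite e memv0 => /eqP.
Qed.

End SubspaceDimension.

(** * Rational complex structures and their forms *)

Section ComplexStructures.
Variable R : realFieldType.

Definition ratmx m n (T : 'M[rat]_(m, n)) : 'M[R]_(m, n) := map_mx ratr T.

Lemma ratmxM m n p (S : 'M_(m, n)) (T : 'M_(n, p)) :
  ratmx (S *m T) = ratmx S *m ratmx T.
Proof. exact: map_mxM. Qed.

Lemma ratmx0 m n : ratmx (0 : 'M_(m, n)) = 0.
Proof. exact: map_mx0. Qed.

Lemma ratmx1 n : ratmx (1%:M : 'M_n) = 1%:M.
Proof. exact: map_mx1. Qed.

Lemma ratmxN m n (S : 'M_(m, n)) : ratmx (- S) = - ratmx S.
Proof. exact: map_mxN. Qed.

Lemma ratmxD m n (S T : 'M_(m, n)) : ratmx (S + T) = ratmx S + ratmx T.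
Proof. exact: map_mxD. Qed.

Lemma ratmxZ m n a (T : 'M_(m, n)) : ratmx (a *: T) = ratr a *: ratmx T.
Proof. exact: map_mxZ. Qed.

Lemma ratmxP m n a (S T : 'M_(m, n)) :
  ratmx (a *: S + T) = ratr a *: ratmx S + ratmx T.
Proof. by rewrite ratmxD ratmxZ. Qed.

Lemma ratmxT m n (T : 'M_(m, n)) : ratmx T^T = (ratmx T)^T.
Proof. by rewrite /ratmx map_trmx. Qed.

Lemma ratmx_inj m n : injective (@ratmx m n).
Proof. exact: map_mx_inj. Qed.

Lemma ratmx_block m1 m2 n1 n2 (a : 'M_(m1, n1)) (b : 'M_(m1, n2))
    (c : 'M_(m2, n1)) (d : 'M_(m2, n2)) :
  ratmx (block_mx a b c d) = block_mx (ratmx a) (ratmx b) (ratmx c) (ratmx d).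
Proof. exact: map_block_mx. Qed.

Lemma ratmx_row m n1 n2 (a : 'M_(m, n1)) (b : 'M_(m, n2)) :
  ratmx (row_mx a b) = row_mx (ratmx a) (ratmx b).
Proof. exact: map_row_mx. Qed.

Lemma ratmx_col m1 m2 n (a : 'M_(m1, n)) (b : 'M_(m2, n)) :
  ratmx (col_mx a b) = col_mx (ratmx a) (ratmx b).
Proof. exact: map_col_mx. Qed.

Lemma ratmx_free m n (T : 'M_(m, n)) : row_free (ratmx T) = row_free T.
Proof. by rewrite /row_free mxrank_map. Qed.

Definition cplx_str n (J : 'M[R]_n) := J *m J = - 1%:M.

(** Both directions multiply on the right by [J^T], whose square is -1. The symmetric matrix
    [J *m Q] is the real part of the Hermitian form with imaginary part [Q]. *)
Lemma cplx_str_sym n (J Q : 'M[R]_n) : cplx_str J -> Q^T = - Q ->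
  (J *m Q *m J^T = Q <-> (J *m Q)^T = J *m Q).
Proof.
move=> cJ QT; rewrite trmx_mul QT mulNmx; split=> [e|e].
  by rewrite -{1}e -(mulmxA (J *m Q)) -trmx_mul cJ linearN /= trmx1 mulmxN mulmx1 opprK.
by rewrite -e mulNmx -mulmxA -trmx_mul cJ linearN /= trmx1 mulmxN mulmx1 opprK.
Qed.

Lemma antisym_form n (Q : 'M[R]_n) (x : 'rV[R]_n) : Q^T = - Q -> x *m Q *m x^T = 0.
Proof.
move=> QT; have e : (x *m Q *m x^T)^T = - (x *m Q *m x^T).
  by rewrite !trmx_mul trmxK QT mulNmx mulmxN mulmxA.
apply/matrixP => i j; rewrite !ord1; move/matrixP: e => /(_ 0 0).
by rewrite !mxE => e; lra.
Qed.

(** Invariant rational pairings; on a product they are the mixed parts of the Neron-Severi classes.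
    Vectors are rows, so multiplication by i is x |-> x *m J. *)
Definition biform n n' (J : 'M[R]_n) (J' : 'M[R]_n') (S : 'M[rat]_(n, n')) :=
  J *m ratmx S *m J'^T = ratmx S.

Definition hodge_hom n n' (J : 'M[R]_n) (J' : 'M[R]_n') (T : 'M[rat]_(n, n')) :=
  J *m ratmx T = ratmx T *m J'.

Definition ns_form n (J : 'M[R]_n) (E : 'M[rat]_n) :=
  E^T = - E /\ biform J J E.

(** The positive quantity is the value H(x, x) of the Hermitian form H with imaginary part [E]. *)
Definition riemann_form n (J : 'M[R]_n) (E : 'M[rat]_n) :=
  ns_form J E /\
  forall x : 'rV[R]_n, x != 0 -> 0 < (x *m J *m ratmx E *m x^T) 0 0.

Definition polarized n (J : 'M[R]_n) := cplx_str J /\ exists E, riemann_form J E.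

Definition rho n (J : 'M[R]_n) := qdim (ns_form J).
Definition hom_rank n n' (J : 'M[R]_n) (J' : 'M[R]_n') := qdim (hodge_hom J J').

Lemma subspace_biform n n' (J : 'M[R]_n) (J' : 'M[R]_n') :
  subspace_pred (biform J J').
Proof.
split; first by rewrite /biform ratmx0 mulmx0 mul0mx.
move=> a S T hS hT; rewrite /biform ratmxP mulmxDr mulmxDl hT.
by rewrite -scalemxAr -scalemxAl hS.
Qed.

Lemma subspace_hodge_hom n n' (J : 'M[R]_n) (J' : 'M[R]_n') :
  subspace_pred (hodge_hom J J').
Proof.
split; first by rewrite /hodge_hom ratmx0 mulmx0 mul0mx.
move=> a S T hS hT; rewrite /hodge_hom ratmxP mulmxDr mulmxDl hT.
by rewrite -scalemxAr -scalemxAl hS.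
Qed.

Lemma subspace_ns_form n (J : 'M[R]_n) : subspace_pred (ns_form J).
Proof.
have [b0 bD] := subspace_biform J J.
split; first by split=> //; rewrite trmx0 oppr0.
move=> a S T [aS bS] [aT bT]; split; last exact: bD.
by rewrite linearP /= aS aT opprD scalerN.
Qed.

(** * Pullback of forms along homomorphisms *)

Section HomForms.
Variables (n n' : nat) (J : 'M[R]_n) (J' : 'M[R]_n').

Lemma hodge_homM p (J'' : 'M[R]_p) S T :
  hodge_hom J J' S -> hodge_hom J' J'' T -> hodge_hom J J'' (S *m T).
Proof. by move=> hS hT; rewrite /hodge_hom ratmxM mulmxA hS -mulmxA hT mulmxA. Qed.

Lemma biform_hom S E : hodge_hom J J' S -> biform J' J' E -> biform J J' (S *m E).
Proof.
by move=> hS hE; rewrite /biform ratmxM mulmxA hS -!mulmxA [J' *m _]mulmxA hE.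
Qed.

Lemma biform_mulT S : cplx_str J' -> biform J J' S -> ratmx S *m J'^T = - (J *m ratmx S).
Proof.
move=> cJ hE; rewrite -{1}hE -mulmxA -trmx_mul cJ linearN /= trmx1.
by rewrite mulmxN mulmx1.
Qed.

Lemma biform_tr S : biform J J' S -> biform J' J S^T.
Proof.
move=> hS; rewrite /biform ratmxT -{2}hS !trmx_mul trmxK; exact: esym (mulmxA _ _ _).
Qed.

Lemma ns_form_pullback T E : hodge_hom J J' T -> ns_form J' E -> ns_form J (T *m E *m T^T).
Proof.
move=> hT [aE bE]; split.
  by rewrite !trmx_mul trmxK aE mulNmx mulmxN mulmxA.
have hT' : ratmx T^T *m J^T = J'^T *m ratmx T^T.
  by rewrite ratmxT -!trmx_mul hT.
rewrite /biform ratmxM mulmxA -mulmxA hT' mulmxA; congr (_ *m _).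
exact: biform_hom.
Qed.

Lemma riemann_form_pos T E (x : 'rV[R]_n) : hodge_hom J J' T -> riemann_form J' E ->
  x *m ratmx T != 0 -> 0 < (x *m J *m ratmx (T *m E *m T^T) *m x^T) 0 0.
Proof.
move=> hT [_ pE] /pE; rewrite !ratmxM ratmxT !mulmxA -[x *m J *m _]mulmxA hT.
by rewrite trmx_mul !mulmxA.
Qed.

(** Some row of [T] is nonzero, and the pullback is positive on the corresponding basis vector. *)
Lemma hom_riemann_neq0 T E : hodge_hom J J' T -> riemann_form J' E ->
  T != 0 -> T *m E *m T^T != 0.
Proof.
move=> hT hE; apply: contra_neq => e0; apply: ratmx_inj; rewrite ratmx0.
apply/row_matrixP => i; rewrite row0; apply/eqP/negPn/negP => Ti.
have := @riemann_form_pos T E (delta_mx 0 i) hT hE.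
by rewrite -rowE e0 ratmx0 mulmx0 mul0mx mxE ltxx => /(_ Ti).
Qed.

Lemma riemann_form_pullback T E : hodge_hom J J' T -> row_free T ->
  riemann_form J' E -> riemann_form J (T *m E *m T^T).
Proof.
move=> hT fT hE; split; first by apply: ns_form_pullback => //; case: hE.
move=> x x0; apply: riemann_form_pos => //.
by rewrite mulmx_free_eq0 ?ratmx_free.
Qed.

(** Positivity survives because [T] stays injective over the reals; cancelling [T] on the right
    shows that [J] squares to -1. *)
Lemma polarized_sub T : hodge_hom J J' T -> row_free T -> polarized J' -> polarized J.
Proof.
move=> hT fT [cJ [E hE]]; split; last by exists (T *m E *m T^T); apply: riemann_form_pullback.
apply: (@row_free_inj _ _ _ _ (ratmx T)); rewrite ?ratmx_free //=.
by rewrite -mulmxA hT mulmxA hT -mulmxA cJ mulmxN mulmx1 mulNmx mul1mx.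
Qed.

End HomForms.

(** By antisymmetry a vector v with v E = 0 also has E v^T = 0, so the positive form would vanish at
    v. *)
Lemma riemann_form_unit n (J : 'M[R]_n) E : riemann_form J E -> E \in unitmx.
Proof.
move=> [[aE _] pE]; rewrite -row_free_unit; apply: inj_row_free => v vE.
apply/eqP/negPn/negP => v0.
have /pE : ratmx v != 0 by apply: contra_neq v0; rewrite -(ratmx0 1 n) => /ratmx_inj.
rewrite -mulmxA -ratmxT -ratmxM.
have -> : E *m v^T = 0 by rewrite -[E]trmxK -trmx_mul aE mulmxN vE oppr0 trmx0.
by rewrite ratmx0 mulmx0 mxE ltxx.
Qed.

Lemma linear_mulmxr (m n p : nat) (A : 'M[rat]_(n, p)) :
  linear (fun S : 'M[rat]_(m, n) => S *m A).
Proof. by move=> a u v; rewrite mulmxDl scalemxAl. Qed.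

(** A polarization [E] of the target identifies it with its dual up to isogeny: right multiplication
    by [E] turns homomorphisms into pairings, and [invmx E] turns them back. *)
Lemma qdim_biform n n' (J : 'M[R]_n) (J' : 'M[R]_n') :
  polarized J' -> qdim (biform J J') = hom_rank J J'.
Proof.
move=> [cJ [E hE]]; have uE := riemann_form_unit hE; have [[aE bE] _] := hE.
have sb := subspace_biform J J'; have sh := subspace_hodge_hom J J'.
apply/eqP; rewrite eqn_leq; apply/andP; split.
  apply: (@qdim_le _ _ _ _ _ (mulmxr (invmx E))) => //; first exact: linear_mulmxr.
    move=> S hS /=; set T := S *m _.
    have SE : T *m E = S by rewrite mulmxKV.
    apply: (can_inj (mulmxK (_ : ratmx E \in unitmx))); first by rewrite map_unitmx.
    have JE : J' *m ratmx E = - (ratmx E *m J'^T) by rewrite (biform_mulT cJ bE) opprK.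
    rewrite -!mulmxA JE mulmxN -ratmxM [in RHS]mulmxA -ratmxM SE.
    by rewrite (biform_mulT cJ hS) opprK.
  by move=> S hS /= S0; apply: (can_inj (mulmxK (_ : invmx E \in unitmx))); rewrite ?unitmx_inv ?S0 ?mul0mx.
apply: (@qdim_le _ _ _ _ _ (mulmxr E)) => //; first exact: linear_mulmxr.
  by move=> S hS /=; apply: biform_hom.
by move=> S hS /= S0; apply: (can_inj (mulmxK uE)); rewrite S0 mul0mx.
Qed.

Lemma linear_trmx m n : linear (@trmx rat m n).
Proof. exact: linearP. Qed.

Lemma qdim_biformC n n' (J : 'M[R]_n) (J' : 'M[R]_n') :
  qdim (biform J J') = qdim (biform J' J).
Proof.
apply/eqP; rewrite eqn_leq; apply/andP; split;
  apply: (@qdim_le _ _ _ _ _ trmx); try exact: linear_trmx;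
  try exact: subspace_biform; try exact: biform_tr;
  by move=> S _ /(congr1 trmx); rewrite trmxK trmx0.
Qed.

(** Transposition exchanges the two sides of a pairing, and the two polarizations translate pairings
    into homomorphisms. *)
Lemma hom_rankC n n' (J : 'M[R]_n) (J' : 'M[R]_n') :
  polarized J -> polarized J' -> hom_rank J J' = hom_rank J' J.
Proof. by move=> pJ pJ'; rewrite -!qdim_biform // qdim_biformC. Qed.

(** * Direct sums of complex structures *)

Definition dsum n n' (J : 'M[R]_n) (J' : 'M[R]_n') : 'M[R]_(n + n') :=
  block_mx J 0 0 J'.

Lemma mul_row_dsum m n n' (J : 'M[R]_n) (J' : 'M[R]_n') (a : 'M_(m, n)) b :
  row_mx a b *m dsum J J' = row_mx (a *m J) (b *m J').
Proof. by rewrite mul_row_block !mulmx0 addr0 add0r. Qed.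

Lemma mul_dsum_col m n n' (J : 'M[R]_n) (J' : 'M[R]_n') (a : 'M_(n, m)) b :
  dsum J J' *m col_mx a b = col_mx (J *m a) (J' *m b).
Proof. by rewrite mul_block_col !mul0mx addr0 add0r. Qed.

Lemma hodge_hom_row n n1 n2 (J : 'M[R]_n) (J1 : 'M[R]_n1) (J2 : 'M[R]_n2) S T :
  hodge_hom J (dsum J1 J2) (row_mx S T) <-> hodge_hom J J1 S /\ hodge_hom J J2 T.
Proof.
rewrite /hodge_hom ratmx_row mul_mx_row mul_row_dsum; split=> [/eq_row_mx //|[-> ->] //].
Qed.

Lemma hodge_hom_col n n1 n2 (J : 'M[R]_n) (J1 : 'M[R]_n1) (J2 : 'M[R]_n2) S T :
  hodge_hom (dsum J1 J2) J (col_mx S T) <-> hodge_hom J1 J S /\ hodge_hom J2 J T.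
Proof.
rewrite /hodge_hom ratmx_col mul_dsum_col mul_col_mx; split=> [/eq_col_mx //|[-> ->] //].
Qed.

Lemma hom_rank_dsumr n n1 n2 (J : 'M[R]_n) (J1 : 'M[R]_n1) (J2 : 'M[R]_n2) :
  hom_rank J (dsum J1 J2) = (hom_rank J J1 + hom_rank J J2)%N.
Proof.
apply: (qdim_split (f := lsubmx) (h := fun T => row_mx 0 T)).
- exact: subspace_hodge_hom.
- exact: subspace_hodge_hom.
- exact: subspace_hodge_hom.
- exact: linearP.
- by move=> a u v; rewrite scale_row_mx add_row_mx scaler0 addr0.
- by move=> u; rewrite -{1}[u]hsubmxK => /hodge_hom_row [].
- move=> w hw; exists (row_mx w 0); last by rewrite row_mxKl.
  by apply/hodge_hom_row; split=> //; case: (subspace_hodge_hom J J2).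
- move=> w hw; rewrite row_mxKl; split=> //.
  by apply/hodge_hom_row; split=> //; case: (subspace_hodge_hom J J1).
- by move=> w /(congr1 rsubmx); rewrite row_mxKr linear0.
move=> u; rewrite -{1}[u]hsubmxK => /hodge_hom_row [_ hu] u0.
by exists (rsubmx u) => //; rewrite -[RHS]hsubmxK u0.
Qed.

Lemma ns_form_dsum n1 n2 (J1 : 'M[R]_n1) (J2 : 'M[R]_n2) a b c d :
  ns_form (dsum J1 J2) (block_mx a b c d) <->
  [/\ ns_form J1 a, biform J1 J2 b, c = - b^T & ns_form J2 d].
Proof.
rewrite /ns_form /biform ratmx_block tr_block_mx opp_block_mx /dsum tr_block_mx.
rewrite !mulmx_block !(trmx0, mulmx0, mul0mx, addr0, add0r).
split=> [[/eq_block_mx [-> _ bc ->] /eq_block_mx [-> -> _ ->]]|].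
  by split=> //; rewrite bc opprK.
move=> [[-> ->] hb -> [-> ->]]; rewrite hb; split; first by rewrite linearN /= trmxK opprK.
congr block_mx; rewrite ratmxN ratmxT mulmxN mulNmx; congr (- _).
by rewrite -{2}hb !trmx_mul trmxK mulmxA.
Qed.

Let linear_ulsubmx n1 n2 : linear (fun E : 'M[rat]_(n1 + n2) => ulsubmx E).
Proof. by move=> a u v; rewrite /ulsubmx !linearP. Qed.

Let linear_drsubmx n1 n2 : linear (fun E : 'M[rat]_(n1 + n2) => drsubmx E).
Proof. by move=> a u v; rewrite /drsubmx !linearP. Qed.

Let ns_form_off n1 n2 (J1 : 'M[R]_n1) (J2 : 'M[R]_n2) (E : 'M[rat]_(n1 + n2)) :=
  ns_form (dsum J1 J2) E /\ ulsubmx E = 0.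

Let subspace_off n1 n2 (J1 : 'M[R]_n1) (J2 : 'M[R]_n2) :
  subspace_pred (@ns_form_off _ _ J1 J2).
Proof.
have [n0 nD] := subspace_ns_form (dsum J1 J2).
split; first by split=> //; rewrite /ulsubmx !linear0.
move=> a u v [hu u0] [hv v0]; split; first exact: nD.
by rewrite linear_ulsubmx u0 v0 scaler0 addr0.
Qed.

(** Rank-nullity is applied twice: to the upper left block, then, on the forms where it vanishes, to
    the lower right block. What remains is the mixed block b, which forces the opposite block to be
    -b^T. *)
Lemma rho_dsum n1 n2 (J1 : 'M[R]_n1) (J2 : 'M[R]_n2) : polarized J2 ->
  rho (dsum J1 J2) = (rho J1 + rho J2 + hom_rank J1 J2)%N.
Proof.
move=> pJ2; rewrite -qdim_biform // -addnA.
have [z1 _] := subspace_ns_form J1; have [z2 _] := subspace_ns_form J2.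
have [zb _] := subspace_biform J1 J2.
rewrite -(_ : qdim (@ns_form_off _ _ J1 J2) = (rho J2 + qdim (biform J1 J2))%N).
  apply: (qdim_split (f := ulsubmx) (h := id)) => //; try exact: subspace_ns_form.
  - exact: linear_ulsubmx.
  - by move=> u; rewrite -{1}[u]submxK => /ns_form_dsum [].
  - move=> w hw; exists (block_mx w 0 0 0); last by rewrite block_mxKul.
    by apply/ns_form_dsum; split=> //; rewrite trmx0 oppr0.
  - by move=> u hu u0; exists u.
apply: (qdim_split (f := drsubmx) (h := fun b => block_mx 0 b (- b^T) 0)) => //.
- exact: subspace_ns_form.
- exact: subspace_biform.
- exact: linear_drsubmx.
- move=> a u v; rewrite scale_block_mx add_block_mx !scaler0 !addr0.
  by rewrite linearP /= opprD scalerN.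
- by move=> u []; rewrite -{1}[u]submxK => /ns_form_dsum [].
- move=> w hw; exists (block_mx 0 0 0 w); last by rewrite block_mxKdr.
  split; last by rewrite block_mxKul.
  by apply/ns_form_dsum; split=> //; rewrite trmx0 oppr0.
- move=> w hw; rewrite block_mxKdr; split=> //; split; last by rewrite block_mxKul.
  exact/ns_form_dsum.
- by move=> w /(congr1 ursubmx); rewrite block_mxKur /ursubmx !linear0.
move=> u []; rewrite -{1}[u]submxK => /ns_form_dsum [_ hb hc _] u0 d0.
by exists (ursubmx u) => //; rewrite -[RHS]submxK u0 d0 hc.
Qed.

Lemma cplx_str_dsum n1 n2 (J1 : 'M[R]_n1) (J2 : 'M[R]_n2) :
  cplx_str J1 -> cplx_str J2 -> cplx_str (dsum J1 J2).
Proof.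
move=> c1 c2; rewrite /cplx_str /dsum mulmx_block !(mulmx0, mul0mx, addr0, add0r) c1 c2.
by rewrite (@scalar_mx_block _ n1 n2) opp_block_mx !oppr0.
Qed.

Lemma polarized_dsum n1 n2 (J1 : 'M[R]_n1) (J2 : 'M[R]_n2) :
  polarized J1 -> polarized J2 -> polarized (dsum J1 J2).
Proof.
move=> [c1 [E1 [n1E p1]]] [c2 [E2 [n2E p2]]]; split; first exact: cplx_str_dsum.
exists (block_mx E1 0 0 E2); split.
  apply/ns_form_dsum; split=> //; first by case: (subspace_biform J1 J2).
  by rewrite trmx0 oppr0.
move=> x; rewrite -[x]hsubmxK => x0.
rewrite mul_row_dsum ratmx_block !ratmx0 mul_row_block !mulmx0 addr0 add0r.
rewrite tr_row_mx mul_row_col mxE.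
have ge0 n (J : 'M[R]_n) (E : 'M[rat]_n) (y : 'rV[R]_n) :
   (forall x : 'rV[R]_n, x != 0 -> 0 < (x *m J *m ratmx E *m x^T) 0 0) ->
   0 <= (y *m J *m ratmx E *m y^T) 0 0.
  have [->|y0 h] := eqVneq y 0; last exact/ltW/h.
  by rewrite !mul0mx mxE.
have [l0|l0] := eqVneq (lsubmx x) 0.
  rewrite ltr_wpDl ?ge0 ?p2 //; apply: contra_neq x0 => r0.
  by rewrite l0 r0 row_mx0.
by rewrite ltr_pwDl ?ge0 ?p1.
Qed.

End ComplexStructures.

(** * Isogenies, simple factors and elliptic curves *)

Section Isogeny.
Variable R : realFieldType.
Implicit Types n m : nat.

(** Sizes such as [n1 + n2] and [n2 + n1] are equal but not convertible, so invertibility is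
    expressed by two rank conditions on a matrix with two size indices. *)
Definition isog n n' (J : 'M[R]_n) (J' : 'M[R]_n') :=
  exists T : 'M[rat]_(n, n'), [/\ row_free T, row_full T & hodge_hom J J' T].

Lemma hodge_hom1 n (J : 'M[R]_n) : hodge_hom J J 1%:M.
Proof. by rewrite /hodge_hom ratmx1 mulmx1 mul1mx. Qed.

Lemma isog_refl n (J : 'M[R]_n) : isog J J.
Proof. by exists 1%:M; split; rewrite ?row_free_unit ?row_full_unit ?unitmx1 //; apply: hodge_hom1. Qed.

Lemma isog_size n n' (J : 'M[R]_n) (J' : 'M[R]_n') : isog J J' -> n = n'.
Proof. by move=> [T [/eqP fT /eqP uT _]]; rewrite -fT -[RHS]uT. Qed.

Lemma isog_of_free n n' (J : 'M[R]_n) (J' : 'M[R]_n') T :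
  n = n' -> row_free T -> hodge_hom J J' T -> isog J J'.
Proof. by move=> nn' fT hT; exists T; split=> //; rewrite /row_full (eqP fT) nn'. Qed.

Lemma isog_sym n n' (J : 'M[R]_n) (J' : 'M[R]_n') : isog J J' -> isog J' J.
Proof.
move=> [T [fT uT hT]]; exists (pinvmx T); split; rewrite ?pinvmx_free ?pinvmx_full //.
apply: (@row_free_inj _ _ _ _ (ratmx R T)); rewrite ?ratmx_free //=.
rewrite -mulmxA -ratmxM mulVpmx // ratmx1 mulmx1 -mulmxA hT mulmxA -ratmxM.
by rewrite mulVpmx // ratmx1 mul1mx.
Qed.

Lemma isog_trans n1 n2 n3 (J1 : 'M[R]_n1) (J2 : 'M[R]_n2) (J3 : 'M[R]_n3) :
  isog J1 J2 -> isog J2 J3 -> isog J1 J3.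
Proof.
move=> [S [fS uS hS]] [T [fT uT hT]]; exists (S *m T); split.
- by rewrite /row_free mxrankMfree.
- by rewrite /row_full mxrankMfree // (eqP uS) -(eqP fT) (eqP uT).
- exact: hodge_homM hT.
Qed.

Let rho_isog_le n n' (J : 'M[R]_n) (J' : 'M[R]_n') : isog J J' -> (rho J' <= rho J)%N.
Proof.
move=> [T [_ /row_fullP [S ST] hT]].
apply: (@qdim_le _ _ _ _ _ (fun E => T *m E *m T^T)); try exact: subspace_ns_form.
- by move=> a u v; rewrite mulmxDr mulmxDl -scalemxAr -scalemxAl.
- by move=> E; apply: (ns_form_pullback hT).
move=> E _ /(congr1 (fun M => S *m M *m S^T)).
rewrite mulmx0 mul0mx !mulmxA ST mul1mx -mulmxA -trmx_mul ST.
by rewrite trmx1 mulmx1.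
Qed.

Lemma rho_isog n n' (J : 'M[R]_n) (J' : 'M[R]_n') : isog J J' -> rho J = rho J'.
Proof.
by move=> h; apply/eqP; rewrite eqn_leq !rho_isog_le //; apply: isog_sym.
Qed.

Lemma isog_dsum n1 n2 n3 n4 (J1 : 'M[R]_n1) (J2 : 'M[R]_n2)
    (J3 : 'M[R]_n3) (J4 : 'M[R]_n4) :
  isog J1 J3 -> isog J2 J4 -> isog (dsum J1 J2) (dsum J3 J4).
Proof.
move=> [S [fS uS hS]] [T [fT uT hT]]; exists (block_mx S 0 0 T); split.
- by rewrite /row_free rank_diag_block_mx (eqP fS) (eqP fT).
- by rewrite /row_full rank_diag_block_mx (eqP uS) (eqP uT).
by apply/hodge_hom_col; split; apply/hodge_hom_row; split=> //;
  case: (subspace_hodge_hom J2 J3) (subspace_hodge_hom J1 J4) => ? _ [].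
Qed.

Let hodge_hom0 n n' (J : 'M[R]_n) (J' : 'M[R]_n') : hodge_hom J J' 0.
Proof. by case: (subspace_hodge_hom J J'). Qed.

Lemma isog_dsumC n1 n2 (J1 : 'M[R]_n1) (J2 : 'M[R]_n2) :
  isog (dsum J1 J2) (dsum J2 J1).
Proof.
apply: (@isog_of_free _ _ _ _ (col_mx (row_mx 0 1%:M) (row_mx 1%:M 0))); first exact: addnC.
  apply: inj_row_free => v; rewrite -[v]hsubmxK mul_row_col !mul_mx_row.
  rewrite !mulmx0 !mulmx1 add_row_mx add0r addr0 => /eqP.
  by rewrite row_mx_eq0 => /andP [/eqP -> /eqP ->]; rewrite row_mx0.
by apply/hodge_hom_col; split; apply/hodge_hom_row; split=> //; apply: hodge_hom1.
Qed.

Lemma isog_dsumA n1 n2 n3 (J1 : 'M[R]_n1) (J2 : 'M[R]_n2) (J3 : 'M[R]_n3) :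
  isog (dsum J1 (dsum J2 J3)) (dsum (dsum J1 J2) J3).
Proof.
apply: (@isog_of_free _ _ _ _ (col_mx (row_mx (row_mx 1%:M 0) 0)
  (col_mx (row_mx (row_mx 0 1%:M) 0) (row_mx 0 1%:M)))); first exact: addnA.
  apply: inj_row_free => v; rewrite -[v]hsubmxK -[rsubmx v]hsubmxK.
  rewrite !mul_row_col !mul_mx_row !mulmx0 !mulmx1 !add_row_mx !(add0r, addr0) => /eqP.
  rewrite add_row_mx addr0 add0r !row_mx_eq0.
  by move=> /andP [/andP [/eqP -> /eqP ->] /eqP ->]; rewrite !row_mx0.
by apply/hodge_hom_col; split; [|apply/hodge_hom_col; split];
  apply/hodge_hom_row; split=> //; try (apply/hodge_hom_row; split=> //);
  apply: hodge_hom1.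
Qed.

Lemma isog_dsum0 n (J0 : 'M[R]_0) (J : 'M[R]_n) : isog J (dsum J0 J).
Proof.
apply: (@isog_of_free _ _ _ _ (row_mx 0 1%:M)) => //.
  apply: inj_row_free => v; rewrite mul_mx_row mulmx1 => /eqP.
  by rewrite row_mx_eq0 => /andP [_ /eqP ->].
by apply/hodge_hom_row; split=> //; apply: hodge_hom1.
Qed.

(** * Simple factors and Poincare reducibility *)

Lemma cplx_str_even n (J : 'M[R]_n) : cplx_str J -> ~~ odd n.
Proof.
move=> /(congr1 determinant); rewrite det_mulmx -scalemx1 -scaleN1r.
rewrite scalerA mulr1 scalemx1 det_scalar => dJ; apply/negP => on.
have : 0 <= \det J * \det J by rewrite -expr2 sqr_ge0.
by rewrite dJ -signr_odd on expr1 oppr_ge0 ler10.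
Qed.

(** If a x + b xJ = 0, applying a - bJ gives (a^2 + b^2) x = 0. *)
Lemma cplx_str_free n (J : 'M[R]_n) (x : 'rV[R]_n) :
  cplx_str J -> x != 0 -> row_free (col_mx x (x *m J)).
Proof.
move=> cJ x0; apply: inj_row_free => v; rewrite -[v]hsubmxK mul_row_col.
rewrite [lsubmx v]mx11_scalar [rsubmx v]mx11_scalar !mul_scalar_mx.
set a := lsubmx v 0 0; set b := rsubmx v 0 0 => e.
have e' : a *: (x *m J) - b *: x = 0.
  move: (congr1 (mulmx^~ J) e) => /=; rewrite mul0mx mulmxDl -!scalemxAl -mulmxA cJ.
  by rewrite mulmxN mulmx1 scalerN.
have : (a ^+ 2 + b ^+ 2) *: x = 0.
  transitivity (a *: (a *: x + b *: (x *m J)) - b *: (a *: (x *m J) - b *: x)).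
    by rewrite scalerDr scalerBr !scalerA scalerDl -!expr2 [b * a]mulrC opprB addrACA subrr addr0.
  by rewrite e e' !scaler0 subr0.
move/eqP; rewrite scaler_eq0 (negPf x0) orbF paddr_eq0 ?sqr_ge0 //.
rewrite !sqrf_eq0 => /andP [/eqP -> /eqP ->].
by rewrite -scalemx1 scale0r row_mx0.
Qed.

(** Simplicity is expressed through classes, the form in which it bounds dimensions. The kernel of a
    nonzero degenerate class would be a proper abelian subvariety, as in [exists_simple_sub]. *)
Definition simple n (J : 'M[R]_n) := forall E, ns_form J E -> E != 0 -> E \in unitmx.

(** The pullback of a Riemann form along [T] is a nonzero class, hence invertible, and this exhibits
    a right inverse of [T]. *)
Lemma simple_hom_free n n' (J : 'M[R]_n) (J' : 'M[R]_n') T :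
  simple J -> polarized J' -> hodge_hom J J' T -> T != 0 -> row_free T.
Proof.
move=> sJ [_ [E hE]] hT T0.
have /sJ : ns_form J (T *m E *m T^T) by apply: (ns_form_pullback hT); case: hE.
move=> /(_ (hom_riemann_neq0 hT hE T0)) u; apply/row_freeP.
exists (E *m T^T *m invmx (T *m E *m T^T)).
by rewrite !mulmxA mulmxV.
Qed.

Lemma hom_rank_simple m n' (J : 'M[R]_m) (J' : 'M[R]_n') :
  (0 < m)%N -> simple J -> polarized J' -> (hom_rank J J' <= n')%N.
Proof.
case: m J => // m J _ sJ pJ'.
rewrite -[leqRHS](dim_rV rat) -qdimT.
apply: (@qdim_le _ _ _ _ _ (row 0)) => //; first exact: subspace_hodge_hom.
  exact: linearP.
move=> T hT T0; apply/eqP/negPn/negP => /(simple_hom_free sJ pJ' hT) fT.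
move: T0 => /eqP; rewrite rowE mulmx_free_eq0 // => /eqP/matrixP/(_ 0 0).
by rewrite !mxE !eqxx.
Qed.

(** A nonzero class is invertible, so its first row is nonzero, while the first entry of that row
    vanishes by antisymmetry. The truncated predecessor covers [m = 0]. *)
Lemma rho_simple m (J : 'M[R]_m) : simple J -> (rho J <= m.-1)%N.
Proof.
case: m J => [|m] J sJ.
  rewrite /rho qdim0 //; first exact: subspace_ns_form.
  by move=> u _; apply: flatmx0.
rewrite -[leqRHS]/m -[leqRHS](dim_rV rat) -qdimT.
apply: (@qdim_le _ _ _ _ _ (fun E : 'M[rat]_m.+1 => \row_(j < m) E 0 (lift 0 j))) => //; first exact: subspace_ns_form.
  by move=> a u v; apply/rowP => j; rewrite !mxE.
move=> E hE E0; apply/eqP/negPn/negP => /(sJ _ hE); rewrite -row_free_unit => fE.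
have : row 0 E = 0.
  apply/rowP => j; rewrite !mxE; have [->|[k ->]] : j = 0 \/ exists k, j = lift 0 k.
    by case: (unliftP 0 j) => [k|] ->; [right; exists k | left].
  - by case: hE => /matrixP/(_ 0 0); rewrite !mxE => e _; lra.
  - by move/rowP: E0 => /(_ k); rewrite !mxE.
move=> /eqP; rewrite rowE mulmx_free_eq0 // => /eqP/matrixP/(_ 0 0).
by rewrite !mxE !eqxx.
Qed.

Lemma stable_hodge_hom m n (J : 'M[R]_n) (T : 'M[rat]_(m, n)) :
  (ratmx R T *m J <= ratmx R T)%MS -> exists J' : 'M[R]_m, hodge_hom J' J T.
Proof.
by move=> st; exists (ratmx R T *m J *m pinvmx (ratmx R T)); rewrite /hodge_hom mulmxKpV.
Qed.

(** Induction on the size: if a nonzero class is degenerate, its kernel is rational and stable under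
    [J], hence a smaller abelian subvariety. *)
Lemma exists_simple_sub n (J : 'M[R]_n) : (0 < n)%N -> polarized J ->
  exists m (J' : 'M[R]_m) (T : 'M[rat]_(m, n)),
    [/\ (0 < m)%N, row_free T, hodge_hom J' J T & simple J'].
Proof.
elim/ltn_ind: n J => n IH J n0 pJ.
have [sJ|nsJ] := pselect (simple J).
  exists n, J, 1%:M; split=> //; first by rewrite row_free_unit unitmx1.
  exact: hodge_hom1.
have [E [[aE bE] E0 nuE]] : exists E, [/\ ns_form J E, E != 0 & E \notin unitmx].
  apply: contrapT => h; apply: nsJ => E hE E0; have [//|nu] := boolP (E \in unitmx).
  by case: h; exists E; split.
have cJ : cplx_str J by case: pJ.
pose T := row_base (kermx E).
have TE : T *m E = 0 by apply/sub_kermxP; rewrite eq_row_base.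
have kE (x : 'M[R]_(\rank (kermx E), n)) : x *m ratmx R E = 0 -> (x <= ratmx R T)%MS.
  move=> /sub_kermxP xk; apply: submx_trans xk _; rewrite -map_kermx.
  by rewrite map_submx eq_row_base.
have [J' hT] : exists J', hodge_hom J' J T.
  apply: stable_hodge_hom; apply: kE.
  have JE : J *m ratmx R E = - (ratmx R E *m J^T) by rewrite (biform_mulT cJ bE) opprK.
  by rewrite -mulmxA JE mulmxN mulmxA -ratmxM TE ratmx0 mul0mx oppr0.
have fT : row_free T := row_base_free _.
have pJ' := polarized_sub hT fT pJ.
have r0 : (0 < \rank E)%N by rewrite lt0n mxrank_eq0.
have rk := mxrank_ker E.
have rn : (\rank E < n)%N.
  rewrite ltn_neqAle rank_leq_row andbT; apply: contra nuE => /eqP e.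
  by rewrite -row_free_unit /row_free e.
have [||m [J'' [S [m0 fS hS sJ'']]]] := IH _ _ _ _ pJ'; rewrite ?rk ?subn_gt0 //; first by lia.
exists m, J'', (S *m T); split=> //; last exact: hodge_homM hT.
by rewrite /row_free mxrankMfree.
Qed.

(** The complement is the orthogonal of the image of [T] for the polarization [E], that is the
    kernel of [E *m T^T]. The dimensions add up because [E] is invertible. *)
Lemma poincare m n (J1 : 'M[R]_m) (J : 'M[R]_n) T :
  polarized J -> row_free T -> hodge_hom J1 J T ->
  exists n2 (J2 : 'M[R]_n2) (T2 : 'M[rat]_(n2, n)),
    [/\ polarized J2, row_free T2, hodge_hom J2 J T2 & isog (dsum J1 J2) J].
Proof.
move=> pJ fT hT; have [cJ [E hE]] := pJ; have [[aE bE] pE] := hE.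
have uE := riemann_form_unit hE.
pose T2 := row_base (kermx (E *m T^T)).
have T2E : T2 *m (E *m T^T) = 0 by apply/sub_kermxP; rewrite eq_row_base.
have [J2 hT2] : exists J2, hodge_hom J2 J T2.
  apply: stable_hodge_hom; apply: (@submx_trans _ _ _ _ _ _ (kermx (ratmx R (E *m T^T)))).
    apply/sub_kermxP; have JE : J *m ratmx R E = - (ratmx R E *m J^T).
      by rewrite (biform_mulT cJ bE) opprK.
    rewrite ratmxM -!mulmxA [J *m _]mulmxA JE mulNmx mulmxN -[ratmx R E *m _ *m _]mulmxA.
    rewrite [ratmx R T^T]ratmxT -trmx_mul -hT trmx_mul -ratmxT !mulmxA -!ratmxM.
    by rewrite -[T2 *m E *m _]mulmxA T2E ratmx0 mul0mx oppr0.
  by rewrite -map_kermx map_submx eq_row_base.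
have fT2 : row_free T2 := row_base_free _.
exists (\rank (kermx (E *m T^T))), J2, T2; split=> //; first exact: polarized_sub hT2 fT2 pJ.
apply: (@isog_of_free _ _ _ _ (col_mx T T2)); last by apply/hodge_hom_col.
  have r : \rank (E *m T^T) = m.
    have uf : row_full E by rewrite row_full_unit.
    by rewrite (eqmxMfull _ uf) mxrank_tr (eqP fT).
  by rewrite mxrank_ker r subnKC // -[leqLHS](eqP fT) rank_leq_col.
rewrite -(ratmx_free R); apply: inj_row_free => v.
rewrite ratmx_col -{1}[v]hsubmxK mul_row_col.
set a := lsubmx v; set b := rsubmx v => ab.
have bT : b *m ratmx R T2 = - (a *m ratmx R T).
  by apply/eqP; rewrite -addr_eq0 addrC ab.
(* A vector in both subspaces is orthogonal to itself and to its image under [J], so positivity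
   forces it to be zero. *)
have b0 : b *m ratmx R T2 = 0.
  apply/eqP/negPn/negP => /pE.
  have -> : (b *m ratmx R T2)^T = - (ratmx R T^T *m a^T).
    by rewrite bT linearN /= trmx_mul ratmxT.
  have -> : b *m ratmx R T2 *m J *m ratmx R E *m - (ratmx R T^T *m a^T) =
            - (b *m J2 *m ratmx R (T2 *m (E *m T^T)) *m a^T).
    by rewrite mulmxN -[b *m _ *m J]mulmxA -hT2 !ratmxM !mulmxA.
  by rewrite T2E ratmx0 mulmx0 mul0mx oppr0 mxE ltxx.
have a0 : a *m ratmx R T = 0 by apply/eqP; rewrite -oppr_eq0 -bT b0.
move: a0 b0 => /eqP; rewrite mulmx_free_eq0 ?ratmx_free // => /eqP a0 /eqP.
rewrite mulmx_free_eq0 ?ratmx_free // => /eqP b0.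
by rewrite -[v]hsubmxK -/a -/b a0 b0 row_mx0.
Qed.

(** * Elliptic curves and complex multiplication *)

Definition cm n (J : 'M[R]_n) := exists U, hodge_hom J J U /\ forall a, U <> a%:M.

Lemma elliptic_simple (J : 'M[R]_2) : simple J.
Proof.
move=> E [aE _] E0; rewrite -row_free_unit.
move/matrixP: aE => aE; have := aE 0 0; have := aE 1 1; have := aE 0 1; rewrite !mxE => e01 e11 e00.
have i2 (i : 'I_2) : i = 0 \/ i = 1 by case: i => [[|[|]]] // ?; [left|right]; apply: val_inj.
have b0 : E 0 1 != 0.
  apply: contra_neq E0 => z; apply/matrixP => i j; rewrite mxE.
  by case: (i2 i) (i2 j) => [] -> [] ->; lra.
apply: inj_row_free => v /rowP vE; apply/rowP => i; rewrite mxE.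
have := vE 1; have := vE 0; rewrite !mxE !big_ord_recl !big_ord0 !addr0 /=.
have -> : lift ord0 ord0 = 1 :> 'I_2 by apply: val_inj.
have [-> ->] : E 0 0 = 0 /\ E 1 1 = 0 by split; lra.
rewrite !mulr0 add0r addr0 e01 mulrN => /eqP; rewrite oppr_eq0.
rewrite mulf_eq0 (negPf b0) orbF => /eqP v1 /eqP.
by rewrite mulf_eq0 (negPf b0) orbF => /eqP v0; case: (i2 i) => ->.
Qed.

Lemma rho_polarized_gt0 n (J : 'M[R]_n) : (0 < n)%N -> polarized J -> (0 < rho J)%N.
Proof.
move=> n0 [_ [E hE]]; rewrite lt0n; apply/eqP => r0.
have E0 : E = 0 by apply: (qdim_eq0 (subspace_ns_form J) r0); case: hE.
have := riemann_form_unit hE; rewrite E0 -row_free_unit /row_free mxrank0.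
by move=> /eqP z; rewrite -z in n0.
Qed.

Lemma rho_elliptic (J : 'M[R]_2) : polarized J -> rho J = 1%N.
Proof.
move=> pJ; apply/eqP; rewrite eqn_leq (rho_simple (@elliptic_simple J)) /=.
exact: rho_polarized_gt0.
Qed.

Lemma hom_rank_cm (J : 'M[R]_2) : polarized J -> cm J -> hom_rank J J = 2%N.
Proof.
move=> pJ [U [hU nU]]; apply/eqP; rewrite eqn_leq hom_rank_simple //=; last exact: elliptic_simple.
apply: (qdim_ge2 (u := 1%:M) (v := U)) => //; first exact: subspace_hodge_hom.
- exact: hodge_hom1.
- by apply/eqP => /matrixP/(_ 0 0); rewrite !mxE.
- by move=> a; rewrite scalemx1; apply: nU.
Qed.

Lemma hom_rank_non_cm n (J : 'M[R]_2) (J' : 'M[R]_n) :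
  polarized J -> polarized J' -> ~ cm J -> (2 * hom_rank J J' <= n)%N.
Proof.
move=> pJ pJ' ncm; have [cJ _] := pJ.
rewrite -[leqRHS](dim_rV rat) mul2n -addnn.
have inj i T : hodge_hom J J' T -> row i T = 0 -> T = 0.
  move=> hT Ti; apply/eqP/negPn/negP => /(simple_hom_free (@elliptic_simple J) pJ' hT) fT.
  move: Ti => /eqP; rewrite rowE mulmx_free_eq0 // => /eqP/matrixP/(_ 0 i).
  by rewrite !mxE !eqxx.
apply: (@qdim_disjoint _ _ _ _ _ _ (row 0) (row 1)); try exact: subspace_hodge_hom;
  try exact: linearP; try exact: inj.
move=> S T hS hT e; apply/eqP/negPn/negP => S0; apply: ncm.
have fS : row_free S.
  apply: (simple_hom_free (@elliptic_simple J) pJ' hS).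
  by apply: contra_neq S0 => ->; rewrite linear0.
(* The rows of [D i] are the i-th basis vector and its image under [J], a real basis of the plane.
   Both [S] and [T] commute with the complex structures, so equality of [row 0 S] and [row 1 T]
   extends to [D 0 *m S = D 1 *m T]. *)
pose D i : 'M[R]_2 := col_mx (delta_mx 0 i : 'rV_2) (delta_mx 0 i *m J).
have uD i : D i \in unitmx.
  rewrite -row_free_unit; apply: cplx_str_free => //.
  by apply/eqP => /matrixP/(_ 0 i); rewrite !mxE !eqxx => /eqP; rewrite oner_eq0.
have eD : D 0 *m ratmx R S = D 1 *m ratmx R T.
  have DM i (X : 'M[R]_(2, n)) :
      D i *m X = col_mx ((delta_mx 0 i : 'rV_2) *m X) (delta_mx 0 i *m J *m X).
    exact: (@mul_col_mx _ 1 1 2 n).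
  rewrite !DM -!mulmxA hS hT !mulmxA -!rowE /ratmx -!map_row.
  by rewrite e.
(* Over the reals the rows of [T] lie in the row space of [S]; this inclusion descends to the
   rationals and yields a rational [U] with [T = U *m S]. *)
have /submxP [U TU] : (T <= S)%MS.
  rewrite -(map_submx (@ratr R)); apply/submxP.
  exists (invmx (D 1) *m D 0).
  by rewrite -[map_mx _ S]/(ratmx R S) -mulmxA eD mulKmx.
exists U; split.
  apply: (@row_free_inj _ _ _ _ (ratmx R S)); rewrite ?ratmx_free //=.
  by rewrite -mulmxA -ratmxM -TU hT TU ratmxM -!mulmxA hS.
(* Since [row 1 T = row 0 S], the second row of [U] is the first basis vector, which is impossible
   for a scalar matrix. *)
move=> a Ua; have : row 1 U = delta_mx 0 0.
  apply: (row_free_inj fS); by rewrite -row_mul -TU -e rowE.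
by rewrite Ua => /matrixP/(_ 0 0); rewrite !mxE.
Qed.

End Isogeny.

(** * Powers of CM curves and the largest Picard numbers *)

Section Structure.
Variable R : realFieldType.

Fixpoint pw n (J : 'M[R]_n) k : 'M[R]_(k * n) :=
  match k with
  | 0 => 0
  | k'.+1 => dsum J (pw J k')
  end.

Lemma mx0_polarized (J : 'M[R]_0) : polarized J.
Proof.
split; first by rewrite /cplx_str flatmx0 [RHS]flatmx0.
exists 0; split; last by move=> x; rewrite thinmx0 eqxx.
by split; rewrite /biform ?(flatmx0, thinmx0) // !flatmx0.
Qed.

Lemma polarized_pw n (J : 'M[R]_n) k : polarized J -> polarized (pw J k).
Proof.
move=> pJ; elim: k => [|k IH] /=; first exact: mx0_polarized.
exact: polarized_dsum.
Qed.

Lemma isog_dsumr0 n (J0 : 'M[R]_0) (J : 'M[R]_n) : isog (dsum J J0) J.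
Proof. exact: isog_trans (isog_dsumC _ _) (isog_sym (isog_dsum0 _ _)). Qed.

Lemma hom_rank_flat n (J0 : 'M[R]_0) (J : 'M[R]_n) : hom_rank J J0 = 0%N.
Proof. by apply: qdim0; [apply: subspace_hodge_hom | move=> u _; apply: thinmx0]. Qed.

Lemma hom_rank_pwr n m (J : 'M[R]_n) (J' : 'M[R]_m) k :
  hom_rank J (pw J' k) = (k * hom_rank J J')%N.
Proof.
elim: k => [|k IH] /=; first exact: hom_rank_flat.
by rewrite hom_rank_dsumr IH.
Qed.

Lemma hom_rank_pwl n m (J : 'M[R]_n) (J' : 'M[R]_m) k :
  polarized J -> polarized J' -> hom_rank (pw J k) J' = (k * hom_rank J J')%N.
Proof.
move=> pJ pJ'; rewrite hom_rankC //; last exact: polarized_pw.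
by rewrite hom_rank_pwr hom_rankC.
Qed.

Lemma hom_rank_isogr n n1 n2 (J : 'M[R]_n) (J1 : 'M[R]_n1) (J2 : 'M[R]_n2) :
  isog J1 J2 -> (hom_rank J J1 <= hom_rank J J2)%N.
Proof.
move=> [T [fT _ hT]].
apply: (@qdim_le _ _ _ _ _ (mulmxr T)); try exact: subspace_hodge_hom.
- exact: linear_mulmxr.
- by move=> S hS; apply: hodge_homM hT.
- by move=> S _ /eqP /=; rewrite mulmx_free_eq0 // => /eqP.
Qed.

Lemma hom_rank_eq0 n n' (J : 'M[R]_n) (J' : 'M[R]_n') T :
  hom_rank J J' = 0%N -> hodge_hom J J' T -> T = 0.
Proof. by move=> h; apply: (qdim_eq0 (subspace_hodge_hom J J')). Qed.

Lemma hom_rank_eq0_isog n n' (J : 'M[R]_n) (J' : 'M[R]_n') :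
  (0 < n)%N -> hom_rank J J' = 0%N -> ~ isog J J'.
Proof.
move=> n0 h [T [/eqP fT _ hT]]; move: fT; rewrite (hom_rank_eq0 h hT) mxrank0.
by move=> e; rewrite -e in n0.
Qed.

Lemma hom_rank_elliptic (J J' : 'M[R]_2) :
  polarized J' -> ~ isog J J' -> hom_rank J J' = 0%N.
Proof.
move=> pJ' ni; apply: qdim0; first exact: subspace_hodge_hom.
move=> T hT; apply/eqP/negPn/negP.
by move=> /(simple_hom_free (@elliptic_simple _ J) pJ' hT) fT; apply: ni; apply: isog_of_free hT.
Qed.

(** Each new factor adds 1 for its own class and 2k for the homomorphisms into the previous k
    copies: (k + 1)^2 = k^2 + 1 + 2k. *)
Lemma rho_pw_cm (J : 'M[R]_2) k : polarized J -> cm J -> rho (pw J k) = (k ^ 2)%N.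
Proof.
move=> pJ cJ; elim: k => [|k IH] /=.
  by apply: qdim0; [apply: subspace_ns_form | move=> u _; apply: flatmx0].
rewrite [LHS](rho_dsum J (polarized_pw k pJ)).
by rewrite IH rho_elliptic // hom_rank_pwr hom_rank_cm //; lia.
Qed.

Lemma rho_pw_dsum (J : 'M[R]_2) k n (J' : 'M[R]_n) :
  polarized J -> cm J -> polarized J' -> hom_rank J J' = 0%N ->
  rho (dsum (pw J k) J') = (k ^ 2 + rho J')%N.
Proof.
by move=> pJ cJ pJ' h; rewrite rho_dsum // rho_pw_cm // hom_rank_pwl // h muln0 addn0.
Qed.

(** A nonzero homomorphism from [E] is injective, so Poincare reducibility splits off one copy of
    [E]; the size drops until no such homomorphism is left. *)
Lemma split_off_power (E : 'M[R]_2) n (J : 'M[R]_n) : polarized E -> polarized J ->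
  exists k n' (J' : 'M[R]_n'),
    [/\ polarized J', n = (k * 2 + n')%N, hom_rank E J' = 0%N
      & isog J (dsum (pw E k) J')].
Proof.
move=> pE; elim/ltn_ind: n J => n IH J pJ.
have [h|h] := eqVneq (hom_rank E J) 0%N.
  exists 0%N, n, J; split=> //; exact: isog_dsum0.
have [T hT T0] : exists2 T, hodge_hom E J T & T != 0.
  apply: contrapT => nT; case/eqP: h; apply: qdim0; first exact: subspace_hodge_hom.
  by move=> T hT; apply/eqP/negPn/negP => T0; apply: nT; exists T.
have fT := simple_hom_free (@elliptic_simple _ E) pJ hT T0.
have [n2 [J2 [_ [pJ2 _ _ iJ]]]] := poincare pJ fT hT.
have n2E := isog_size iJ.
have [|k [n' [J' [pJ' n'E h' i2]]]] := IH n2 _ J2 pJ2; first by rewrite -n2E.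
exists k.+1, n', J'; split=> //; first by rewrite -n2E n'E mulSn addnA.
apply: isog_trans (isog_sym iJ) _.
apply: isog_trans (isog_dsum (isog_refl E) i2) _.
exact: isog_dsumA.
Qed.

Lemma rho_simple_split n (J : 'M[R]_n) : (0 < n)%N -> polarized J ->
  exists m n' (B : 'M[R]_m) (J' : 'M[R]_n') S T,
    [/\ [/\ (0 < m)%N, ~~ odd m, simple B, polarized B & polarized J'],
        (m + n')%N = n,
        rho J = (rho B + rho J' + hom_rank B J')%N,
        @row_free _ m n S /\ hodge_hom B J S & @row_free _ n' n T /\ hodge_hom J' J T].
Proof.
move=> n0 pJ; have [m [B [S [m0 fS hS sB]]]] := exists_simple_sub n0 pJ.
have pB := polarized_sub hS fS pJ.
have [n' [J' [T [pJ' fT hT iJ]]]] := poincare pJ fS hS.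
exists m, n', B, J', S, T; split=> //.
- by split=> //; apply: (@cplx_str_even _ _ B); case: pB.
- exact: isog_size iJ.
- by rewrite -(rho_isog iJ) rho_dsum.
Qed.

(** With m = 2d the induction needs 4 (2d - 1) + 4 n' <= 4 d^2 + 4 d n', which holds for d >= 1
    because (d - 1)^2 >= 0. *)
Lemma rho_le n (J : 'M[R]_n) : polarized J -> (4 * rho J <= n ^ 2)%N.
Proof.
elim/ltn_ind: n J => n IH J pJ.
have [n0|n0] := posnP n.
  rewrite /rho qdim0 //; first exact: subspace_ns_form.
  by subst n; move=> u _; apply: flatmx0.
have [m [n' [B [J' [_ [_ [[m0 em sB pB pJ'] nE -> _ _]]]]]]] := rho_simple_split n0 pJ.
have := IH n' _ J' pJ'; have := rho_simple sB; have := hom_rank_simple m0 sB pJ'.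
have [d md] : exists d, m = d.*2 by exists m./2; rewrite -[LHS]odd_double_half (negPf em).
have n'n : (n' < n)%N by rewrite -nE -[ltnLHS]add0n ltn_add2r.
move=> h1 h2 /(_ n'n) h3; rewrite -nE.
move: h1 h2 h3 m0; move: (rho B) (rho J') (hom_rank B J') => x y z.
rewrite md; clear; nia.
Qed.

Lemma rho_le_sq n g (J : 'M[R]_n) : polarized J -> n = (g * 2)%N -> (rho J <= g ^ 2)%N.
Proof.
move=> pJ nE; have := rho_le pJ; move: (rho J) => r; rewrite nE expnMn mulnC.
by rewrite (_ : 2 ^ 2 = 4)%N // leq_pmul2r.
Qed.

Definition no_cm_curve n (J : 'M[R]_n) :=
  forall (E : 'M[R]_2) T, hodge_hom E J T -> row_free T -> ~ cm E.

Lemma no_cm_curve_sub n n' (J : 'M[R]_n) (J' : 'M[R]_n') T :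
  hodge_hom J' J T -> row_free T -> no_cm_curve J -> no_cm_curve J'.
Proof.
move=> hT fT nJ E S hS fS; apply: (nJ E (S *m T)); first exact: hodge_homM hT.
by rewrite /row_free mxrankMfree.
Qed.

(** With m = 2d the simple factor contributes 8 (2d - 1) <= 4 d (d + 1), which amounts to (d - 1) (d
    - 2) >= 0. The homomorphisms have to fit in the cross term 2 m n'. *)
Lemma rho_no_cm n (J : 'M[R]_n) :
  polarized J -> no_cm_curve J -> (8 * rho J <= n * (n + 2))%N.
Proof.
elim/ltn_ind: n J => n IH J pJ nJ.
have [n0|n0] := posnP n.
  rewrite /rho qdim0 //; first exact: subspace_ns_form.
  by subst n; move=> u _; apply: flatmx0.
have [m [n' [B [J' [S [T [[m0 em sB pB pJ'] nE -> [fS hS] [fT hT]]]]]]]] := rho_simple_split n0 pJ.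
have n'n : (n' < n)%N by rewrite -nE -[ltnLHS]add0n ltn_add2r.
have := IH n' n'n J' pJ' (no_cm_curve_sub hT fT nJ).
have := rho_simple sB.
(* A simple factor of size 2 is a curve without complex multiplication and obeys the halved bound;
   from size 4 on the general bound n' is enough. *)
have : (4 * hom_rank B J' <= m * n')%N.
  have [m2|m2] := eqVneq m 2%N.
    subst m; have := hom_rank_non_cm pB pJ' (nJ _ _ hS fS); lia.
  have := hom_rank_simple m0 sB pJ'; have : (4 <= m)%N by lia.
  clear; nia.
have [d md] : exists d, m = d.*2 by exists m./2; rewrite -[LHS]odd_double_half (negPf em).
rewrite -nE; move: m0; move: (rho B) (rho J') (hom_rank B J') => x y z.
rewrite md; clear; case: d => [|[|d]]; nia.
Qed.

Lemma cm_dichotomy n (J : 'M[R]_n) : polarized J ->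
  (8 * rho J <= n * (n + 2))%N \/
  exists (E : 'M[R]_2) k n' (J' : 'M[R]_n'),
    [/\ [/\ polarized E, cm E, polarized J' & (0 < k)%N], n = (k * 2 + n')%N,
        hom_rank E J' = 0%N, isog J (dsum (pw E k) J') & rho J = (k ^ 2 + rho J')%N].
Proof.
move=> pJ; have [nJ|nJ] := pselect (no_cm_curve J); first by left; apply: rho_no_cm.
right; have [E [T [hT fT cE]]] : exists (E : 'M[R]_2) T, [/\ hodge_hom E J T, row_free T & cm E].
  apply: contrapT => h; apply: nJ => E T hT fT cE; apply: h; exists E, T.
  by split.
have pE := polarized_sub hT fT pJ.
have [k [n' [J' [pJ' nE h iJ]]]] := split_off_power pE pJ.
exists E, k, n', J'; split=> //; last by rewrite (rho_isog iJ) rho_pw_dsum.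
(* If k were 0, then [J] would be isogenous to [J'], which receives no nonzero homomorphism from
   [E], whereas [E] embeds in [J] by [T]. *)
split=> //; rewrite lt0n; apply/eqP => k0; subst k.
have [S [fS _ hS]] := isog_trans iJ (isog_sym (isog_dsum0 (pw E 0) J')).
have := hom_rank_eq0 h (hodge_homM hT hS) => /eqP; rewrite mulmx_free_eq0 // => /eqP T0.
by move: fT; rewrite T0 /row_free mxrank0.
Qed.

Lemma even_polarized n (J : 'M[R]_n) : polarized J -> exists g, n = (g * 2)%N.
Proof.
move=> [cJ _]; exists n./2; have := cplx_str_even cJ; rewrite muln2 => on.
by rewrite -[LHS]odd_double_half (negPf on).
Qed.

(** For g > 1 the bound g (g + 1) / 2 is below g^2, so there is a CM curve. Then (k + g')^2 <= k^2 +
    g'^2 with k > 0 forces g' = 0. For g = 1 the curve may lack complex multiplication, hence the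
    guarded last clause. *)
Lemma rho_max n g (J : 'M[R]_n) : polarized J -> n = (g * 2)%N -> (0 < g)%N ->
  rho J = (g ^ 2)%N ->
  exists E : 'M[R]_2, [/\ polarized E, isog J (pw E g) & (1 < g)%N -> cm E].
Proof.
move=> pJ nE g0 rJ; have [g1|g1] := eqVneq g 1%N.
  subst g; subst n; exists J; split=> //; first exact: (isog_sym (isog_dsumr0 _ _)).
have [|[E [k [n' [J' [[pE cE pJ' k0] nE' h iJ rJ']]]]]] := cm_dichotomy pJ.
  by rewrite rJ => le; exfalso; subst n; clear -le g0 g1; nia.
have [g' g'E] := even_polarized pJ'; have le := rho_le_sq pJ' g'E.
have ge : g = (k + g')%N by lia.
rewrite rJ ge in rJ'.
have : g' = 0%N by nia.
move=> g'0; rewrite g'0 in g'E; subst n'; exists E; split=> //.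
have -> : g = k by lia.
exact: isog_trans iJ (isog_dsumr0 _ _).
Qed.

Lemma isog_pw1 n (J : 'M[R]_n) : isog (pw J 1) J.
Proof. exact: isog_dsumr0. Qed.

Lemma hom_rank_pw_eq0 (E1 E2 : 'M[R]_2) n (J : 'M[R]_n) g :
  hom_rank E1 J = 0%N -> isog J (pw E2 g) -> (0 < g)%N -> hom_rank E1 E2 = 0%N.
Proof.
move=> h iJ g0; have := hom_rank_isogr E1 (isog_sym iJ).
by rewrite h hom_rank_pwr leqn0 muln_eq0 => /orP [/eqP z|/eqP //]; rewrite z in g0.
Qed.

(** The guard on [cm E2] lets one definition cover both cases: a single copy of the second curve has
    Picard number 1 with or without complex multiplication. *)
Definition two_powers n (J : 'M[R]_n) a b :=
  exists E1 E2 : 'M[R]_2,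
    [/\ [/\ polarized E1, polarized E2 & hom_rank E1 E2 = 0%N],
        isog J (dsum (pw E1 a) (pw E2 b)), cm E1 & (1 < b)%N -> cm E2].

Lemma two_powers_split n (J : 'M[R]_n) (E : 'M[R]_2) k g' n' (J' : 'M[R]_n') :
  polarized E -> cm E -> polarized J' -> n' = (g' * 2)%N -> (0 < g')%N ->
  hom_rank E J' = 0%N -> isog J (dsum (pw E k) J') -> rho J' = (g' ^ 2)%N ->
  two_powers J k g'.
Proof.
move=> pE cE pJ' n'E g'0 h iJ rJ'.
have [E2 [pE2 iE2 cE2]] := rho_max pJ' n'E g'0 rJ'.
exists E, E2; split=> //; first by split=> //; apply: hom_rank_pw_eq0 iE2 g'0.
exact: isog_trans iJ (isog_dsum (isog_refl _) iE2).
Qed.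

(** The first curve must have complex multiplication, and [1 < b] is what provides it for the curve
    that moves to the front. *)
Lemma two_powersC n (J : 'M[R]_n) a b : (1 < b)%N -> two_powers J a b -> two_powers J b a.
Proof.
move=> b1 [E1 [E2 [[p1 p2 h] iJ c1 c2]]]; exists E2, E1; split.
- by split=> //; rewrite hom_rankC.
- exact: isog_trans iJ (isog_dsumC _ _).
- exact: c2.
- by [].
Qed.

Lemma rho_two_powers n (J : 'M[R]_n) a b : two_powers J a b -> (0 < b)%N ->
  rho J = (a ^ 2 + b ^ 2)%N.
Proof.
move=> [E1 [E2 [[p1 p2 h] iJ c1 c2]]] b0.
have pb := polarized_pw b p2.
rewrite (rho_isog iJ) rho_pw_dsum // ?hom_rank_pwr ?h ?muln0 //; congr (_ + _)%N.
have [b1|b1] := leqP b 1; last by apply: rho_pw_cm p2 (c2 b1).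
by have -> : b = 1%N by [lia]; rewrite (rho_isog (isog_pw1 E2)) rho_elliptic.
Qed.

(* [g (g + 1) / 2] and the values k^2 + (g - k)^2 with 1 < k < g - 1 stay
   below (g - 1)^2 + 1 as soon as g >= 5 *)
Lemma rho_second n g (J : 'M[R]_n) : polarized J -> n = (g * 2)%N -> (5 <= g)%N ->
  rho J = ((g - 1) ^ 2 + 1)%N -> two_powers J (g - 1) 1.
Proof.
move=> pJ nE g5 rJ.
have [|[E [k [n' [J' [[pE cE pJ' k0] nE' h iJ rJ']]]]]] := cm_dichotomy pJ.
  by rewrite rJ => le; exfalso; subst n; clear -le g5; nia.
have [g' g'E] := even_polarized pJ'; have le := rho_le_sq pJ' g'E.
have ge : g = (k + g')%N by lia.
rewrite rJ in rJ'.
have [g'0|g'0] := eqVneq g' 0%N; first by exfalso; subst g'; nia.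
have [g'1|g'1] := eqVneq g' 1%N.
  have kE : (g - 1)%N = k by lia.
  rewrite kE; apply: (two_powers_split pE cE pJ' _ _ h iJ) => //; first by rewrite g'E g'1.
  by rewrite -kE in rJ'; lia.
(* For k = 1 it is the complement that reaches the maximal value (g - 1)^2, and the two curves
   exchange roles. *)
have [k1|k1] := eqVneq k 1%N; last by exfalso; nia.
subst k; have g'g : (g - 1)%N = g' by lia.
rewrite g'g; apply: two_powersC; first by lia.
apply: (two_powers_split pE cE pJ' g'E _ h iJ); first by lia.
by rewrite g'g in rJ'; lia.
Qed.

(** The inequality g (g + 1) / 2 < (g - 2)^2 + 4 holds from g = 7 on and fails at g = 6. For 3 <= k
    <= g - 3 the sum k^2 + g'^2 stays below the given value, and k >= g - 1 exceeds it. The cases g'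
    = 2 and k = 2 are the two orders of the factors, and k = 1 is excluded by a second use of the
    dichotomy. *)
Lemma rho_third n g (J : 'M[R]_n) : polarized J -> n = (g * 2)%N -> (7 <= g)%N ->
  rho J = ((g - 2) ^ 2 + 4)%N -> two_powers J (g - 2) 2.
Proof.
move=> pJ nE g7 rJ.
have [|[E [k [n' [J' [[pE cE pJ' k0] nE' h iJ rJ']]]]]] := cm_dichotomy pJ.
  by rewrite rJ => le; exfalso; subst n; clear -le g7; nia.
have [g' g'E] := even_polarized pJ'; have le := rho_le_sq pJ' g'E.
have ge : g = (k + g')%N by lia.
rewrite rJ in rJ'.
have [g'0|g'0] := eqVneq g' 0%N; first by exfalso; subst g'; nia.
have [g'1|g'1] := eqVneq g' 1%N.
  exfalso; subst g'; nia.
have [g'2|g'2] := eqVneq g' 2%N.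
  have kE : (g - 2)%N = k by lia.
  rewrite kE; apply: (two_powers_split pE cE pJ' _ _ h iJ) => //; first by rewrite g'E g'2.
  by rewrite -kE in rJ'; lia.
have [k2|k2] := eqVneq k 2%N.
  subst k; have g'g : (g - 2)%N = g' by lia.
  rewrite g'g; apply: two_powersC; first by lia.
  apply: (two_powers_split pE cE pJ' g'E _ h iJ); first by lia.
  by rewrite g'g in rJ'; lia.
exfalso; have [k1|k1] := eqVneq k 1%N; last by nia.
(* for k = 1 the complement would have Picard number (g' - 1)^2 + 3 *)
subst k; have [|[E' [k' [n'' [J'' [[_ _ pJ'' k'0] nE'' _ _ rJ'']]]]]] := cm_dichotomy pJ'.
  by move=> le'; exfalso; subst n'; nia.
have [g'' g''E] := even_polarized pJ''; have le' := rho_le_sq pJ'' g''E.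
have ge' : g' = (k' + g'')%N by lia.
have rE : rho J' = ((g' - 1) ^ 2 + 3)%N by nia.
rewrite rE in rJ''.
have [z|z] := eqVneq g'' 0%N; first by subst g''; nia.
have [z1|z1] := eqVneq g'' 1%N; first by subst g''; nia.
by have [k1|k1] := eqVneq k' 1%N; nia.
Qed.

End Structure.

(** * Lattices in complex coordinates *)

Lemma clear_denominators m n (T : 'M[rat]_(m, n)) :
  exists D (Z : 'M[int]_(m, n)), (0 < D)%N /\ D%:R *: T = map_mx intr Z.
Proof.
pose d i j := `|denq (T i j)|%N.
pose D := (\prod_i \prod_j d i j)%N.
have d_gt0 i j : (0 < d i j)%N by rewrite absz_gt0 denq_neq0.
have dD i j : (d i j %| D)%N.
  rewrite /D (bigD1 i) //= (bigD1 j) //= -!mulnA; exact: dvdn_mulr.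
exists D, (\matrix_(i, j) (numq (T i j) * (D %/ d i j)%N%:Z)); split.
  by apply: prodn_gt0 => i; apply: prodn_gt0.
apply/matrixP => i j; rewrite !mxE intrM numqE.
rewrite -{1}(divnK (dD i j)) natrM mulrC -mulrA; congr (_ * _).
by rewrite mulrC /d -(absz_denq (T i j)).
Qed.

Section ComplexMatrices.
Variable R : realType.
Local Notation C := (R[i])%C.
Local Notation ii := (Complex 0 1 : C).

Definition cmx m n (A : 'M[R]_(m, n)) : 'M[C]_(m, n) := map_mx (real_complex R) A.
Definition remx m n (A : 'M[C]_(m, n)) : 'M[R]_(m, n) := map_mx (@complex.Re R) A.
Definition immx m n (A : 'M[C]_(m, n)) : 'M[R]_(m, n) := map_mx (@complex.Im R) A.
Definition ctr m n (A : 'M[C]_(m, n)) : 'M[C]_(n, m) := map_mx Num.conj A^T.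

Lemma cmxM m n p (A : 'M_(m, n)) (B : 'M_(n, p)) : cmx (A *m B) = cmx A *m cmx B.
Proof. exact: map_mxM. Qed.

Lemma cmxD m n (A B : 'M_(m, n)) : cmx (A + B) = cmx A + cmx B.
Proof. exact: map_mxD. Qed.

Lemma cmxN m n (A : 'M_(m, n)) : cmx (- A) = - cmx A.
Proof. exact: map_mxN. Qed.

Lemma cmx0 m n : cmx (0 : 'M_(m, n)) = 0.
Proof. exact: map_mx0. Qed.

Lemma cmx1 n : cmx (1%:M : 'M_n) = 1%:M.
Proof. exact: map_mx1. Qed.

Lemma cmx_reim m n (A : 'M_(m, n)) : A = cmx (remx A) + ii *: cmx (immx A).
Proof.
apply/matrixP => i j; rewrite !mxE; case: (A i j) => a b /=.
by apply/eqP; rewrite eq_complex /=; apply/andP; split; apply/eqP; ring.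
Qed.

Lemma remxE m n (A B : 'M_(m, n)) : remx (cmx A + ii *: cmx B) = A.
Proof. by apply/matrixP => i j; rewrite !mxE /=; ring. Qed.

Lemma immxE m n (A B : 'M_(m, n)) : immx (cmx A + ii *: cmx B) = B.
Proof. by apply/matrixP => i j; rewrite !mxE /=; ring. Qed.

Lemma cmx_reim_inj m n (A B A' B' : 'M_(m, n)) :
  cmx A + ii *: cmx B = cmx A' + ii *: cmx B' -> A = A' /\ B = B'.
Proof.
move=> e; split; first by rewrite -(remxE A B) e remxE.
by rewrite -(immxE A B) e immxE.
Qed.

Lemma iiK m n (A : 'M[C]_(m, n)) : ii *: (ii *: A) = - A.
Proof.
rewrite scalerA -scaleN1r; congr (_ *: _).
by apply/eqP; rewrite eq_complex /=; apply/andP; split; apply/eqP; ring.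
Qed.

Lemma iiZ m n (A B : 'M_(m, n)) :
  ii *: (cmx A + ii *: cmx B) = cmx (- B) + ii *: cmx A.
Proof. by rewrite scalerDr iiK addrC cmxN. Qed.

Lemma conjCE (z : C) : Num.conj z = conjc z. Proof. by []. Qed.

Lemma ctrM m n p (A : 'M_(m, n)) (B : 'M_(n, p)) : ctr (A *m B) = ctr B *m ctr A.
Proof. by rewrite /ctr trmx_mul map_mxM. Qed.

Lemma ctr_cmx m n (A : 'M_(m, n)) : ctr (cmx A) = cmx A^T.
Proof. by apply/matrixP => i j; rewrite !mxE; apply: conjc_real. Qed.

Lemma ctr_reim m n (A B : 'M_(m, n)) :
  ctr (cmx A + ii *: cmx B) = cmx A^T + ii *: cmx (- B^T).
Proof.
apply/matrixP => i j; rewrite !mxE; apply: etrans (conjCE _) _ => /=.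
by apply/eqP; rewrite eq_complex /=; apply/andP; split; apply/eqP; ring.
Qed.

Lemma ctrK m n (A : 'M_(m, n)) : ctr (ctr A) = A.
Proof. by apply/matrixP => i j; rewrite !mxE conjCK. Qed.

Lemma hermsymP n (H : 'M[C]_n) : H \is hermsymmx <-> ctr H = H.
Proof.
split=> [/is_hermitianmxP|h]; last apply/is_hermitianmxP; by rewrite expr0 scale1r.
Qed.

Lemma formE n (H : 'M[C]_n) u v : form Num.conj H u v = (u *m H *m ctr v) 0 0.
Proof. by []. Qed.

End ComplexMatrices.

(** * Period matrices and Gram matrices of Hermitian forms *)

Section Models.
Variable R : realType.
Local Notation C := (R[i])%C.
Local Notation ii := (Complex 0 1 : C).

Definition rbasis n g (B : 'M[C]_(n, g)) :=
  forall v : 'rV[C]_g, exists! x : 'rV[R]_n, v = cmx x *m B.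

Section RealBasis.
Variables (n g : nat) (B : 'M[C]_(n, g)).
Hypothesis bB : rbasis B.

Lemma rbasis_inj m : injective (fun X : 'M[R]_(m, n) => cmx X *m B).
Proof.
move=> X Y /= e; apply/row_matrixP => i; have [z [_ uz]] := bB (row i (cmx X *m B)).
rewrite -(uz (row i X)); last by rewrite row_mul /cmx map_row.
by rewrite -(uz (row i Y)) // e row_mul /cmx map_row.
Qed.

Lemma rbasis_ex m (A : 'M[C]_(m, g)) : exists X : 'M[R]_(m, n), A = cmx X *m B.
Proof.
have /choice [x xP] : forall i, exists x : 'rV[R]_n, row i A = cmx x *m B.
  by move=> i; have [x [e _]] := bB (row i A); exists x.
exists (\matrix_i x i); apply/row_matrixP => i.
by rewrite xP row_mul /cmx -map_row rowK.
Qed.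

Lemma rbasis_full : exists X : 'M[R]_(g, n), cmx X *m B = 1%:M.
Proof. by have [X e] := rbasis_ex 1%:M; exists X. Qed.

(** Separating real and imaginary parts gives an n by 2g real matrix. It is injective by uniqueness
    of coordinates, and the real coordinates of the matrices 1 and i provide a left inverse. *)
Lemma rbasis_size : n = (g * 2)%N.
Proof.
have nE : row_free (row_mx (remx B) (immx B)).
  apply: inj_row_free => v; rewrite mul_mx_row => /eqP.
  rewrite row_mx_eq0 => /andP [/eqP vr /eqP vi].
  apply: rbasis_inj; rewrite /= cmx0 mul0mx [B]cmx_reim mulmxDr -scalemxAr -!cmxM.
  by rewrite vr vi cmx0 scaler0 addr0.
have [X XB] := rbasis_full; have [Y YB] := rbasis_ex (ii%:M : 'M_g).
have fE : row_full (row_mx (remx B) (immx B)).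
  apply/row_fullP; exists (col_mx X Y).
  have e (Z : 'M[R]_(g, n)) P Q : cmx Z *m B = cmx P + ii *: cmx Q ->
      Z *m row_mx (remx B) (immx B) = row_mx P Q.
    rewrite {1}[B]cmx_reim mulmxDr -scalemxAr -!cmxM => /cmx_reim_inj [<- <-].
    by rewrite mul_mx_row.
  rewrite mul_col_mx (@e X 1%:M 0); last by rewrite XB cmx0 scaler0 addr0 cmx1.
  rewrite (@e Y 0 1%:M); last by rewrite -YB cmx0 add0r cmx1 scalemx1.
  by rewrite [RHS]scalar_mx_block.
by rewrite -[LHS](eqP nE) (eqP fE) addnn muln2.
Qed.

Lemma rbasis_cplx : exists J : 'M[R]_n, cmx J *m B = ii *: B.
Proof. by have [J e] := rbasis_ex (ii *: B); exists J. Qed.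

Section ComplexStructure.
Variable J : 'M[R]_n.
Hypothesis JB : cmx J *m B = ii *: B.

Lemma cplx_str_model : cplx_str J.
Proof.
apply: rbasis_inj; rewrite /= cmxM -mulmxA JB -scalemxAr JB.
by rewrite iiK (cmxN (1%:M)) cmx1 mulNmx mul1mx.
Qed.

(** After multiplication by [B] the matrix [J] becomes the scalar i, and the left side recombines to
    B X B = B. *)
Lemma model_resolution X : cmx X *m B = 1%:M -> remx B *m X + immx B *m X *m J = 1%:M.
Proof.
move=> XB; apply: rbasis_inj; rewrite /= cmx1 mul1mx cmxD !cmxM mulmxDl.
by rewrite -!mulmxA XB JB -scalemxAr XB mulmx1 -scalemxAr mulmx1 -cmx_reim.
Qed.

(* [cmx X] inverts [B] on the left, but [B *m cmx X] is the projection to the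
   i-eigenspace of [J] along the other one, hence the hypothesis on [G]. *)
Lemma model_proj m X (G : 'M[C]_(n, m)) :
  cmx X *m B = 1%:M -> cmx J *m G = ii *: G -> B *m cmx X *m G = G.
Proof.
move=> XB JG; rewrite [B]cmx_reim !mulmxDl -!scalemxAl -!cmxM.
rewrite [ii *: _]scalemxAr -JG mulmxA -cmxM -mulmxDl -cmxD.
by rewrite model_resolution // cmx1 mul1mx.
Qed.

Lemma model_hom n' g' (B' : 'M[C]_(n', g')) J' T :
  cmx J' *m B' = ii *: B' -> J *m T = T *m J' ->
  exists M : 'M[C]_(g, g'), B *m M = cmx T *m B'.
Proof.
move=> JB' hT; have [X XB] := rbasis_full.
exists (cmx X *m (cmx T *m B')); rewrite mulmxA model_proj //.
by rewrite mulmxA -cmxM hT cmxM -mulmxA JB' scalemxAr.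
Qed.

Definition gram (H : 'M[C]_g) : 'M[C]_n := B *m H *m ctr B.

Lemma gram_J H : cmx J *m gram H = ii *: gram H.
Proof. by rewrite /gram !mulmxA JB -!scalemxAl. Qed.

Lemma gram_form H (x y : 'rV[R]_n) :
  form Num.conj H (cmx x *m B) (cmx y *m B) = (cmx x *m gram H *m cmx y^T) 0 0.
Proof. by rewrite formE ctrM ctr_cmx /gram !mulmxA. Qed.

Lemma gram_herm H : ctr H = H -> ctr (gram H) = gram H.
Proof. by move=> hH; rewrite /gram !ctrM ctrK hH mulmxA. Qed.

Lemma gram_eq0 H : gram H = 0 -> H = 0.
Proof.
have [X XB] := rbasis_full => G0.
transitivity (cmx X *m gram H *m ctr (cmx X)); last by rewrite G0 mulmx0 mul0mx.
rewrite /gram !mulmxA XB mul1mx -mulmxA -ctrM XB.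
by rewrite /ctr trmx1 map_mx1 mulmx1.
Qed.

(** Comparing imaginary parts in J G = i G shows that the real part of the Gram matrix G is J Q;
    Hermitian symmetry then makes J Q symmetric and Q antisymmetric. *)
Lemma gram_relations H : ctr H = H -> let Q := immx (gram H) in
  [/\ gram H = cmx (J *m Q) + ii *: cmx Q, Q^T = - Q & J *m Q *m J^T = Q].
Proof.
move=> hH Q; set P := remx (gram H).
have GE : gram H = cmx P + ii *: cmx Q by exact: cmx_reim.
have := gram_J H; rewrite GE iiZ mulmxDr -scalemxAr -!cmxM => /cmx_reim_inj [_ JQ].
have := gram_herm hH; rewrite GE ctr_reim => /cmx_reim_inj [PT QT].
have QT' : Q^T = - Q by rewrite -[in RHS]QT opprK.
split=> //; first by rewrite JQ.
by apply/(cplx_str_sym cplx_str_model QT'); rewrite JQ.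
Qed.

(** The form is H = X G X^*, with X the left inverse of [B]. The product B X fixes G on the left by
    [model_proj], and its adjoint fixes G on the right because G is Hermitian. *)
Lemma gram_ex Q : Q^T = - Q -> J *m Q *m J^T = Q ->
  exists H, ctr H = H /\ gram H = cmx (J *m Q) + ii *: cmx Q.
Proof.
move=> QT QJ; set G := _ + _.
have JG : cmx J *m G = ii *: G.
  rewrite /G iiZ mulmxDr -scalemxAr -!cmxM mulmxA cplx_str_model mulNmx mul1mx.
  by [].
have JQT := (cplx_str_sym cplx_str_model QT).1 QJ.
have cG : ctr G = G.
  by rewrite /G ctr_reim JQT QT opprK.
have [X XB] := rbasis_full.
exists (cmx X *m G *m cmx X^T); split.
  by rewrite !ctrM cG -!ctr_cmx ctrK mulmxA.
rewrite /gram !mulmxA model_proj // -mulmxA -ctr_cmx -ctrM.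
by rewrite -[in LHS]cG -ctrM model_proj.
Qed.

Lemma gram_pos H (x : 'rV[R]_n) : ctr H = H ->
  form Num.conj H (cmx x *m B) (cmx x *m B) =
  real_complex R ((x *m J *m immx (gram H) *m x^T) 0 0).
Proof.
move=> /gram_relations [GE QT _]; set Q := immx _ in GE QT *.
rewrite gram_form GE mulmxDr mulmxDl -scalemxAr -scalemxAl -!cmxM.
by rewrite (antisym_form x QT) cmx0 scaler0 addr0 mulmxA mxE.
Qed.

End ComplexStructure.
End RealBasis.

End Models.

(** * Models of abelian varieties *)

Section Varieties.
Variable R : realType.
Local Notation C := (R[i])%C.
Local Notation ii := (Complex 0 1 : C).

Definition zmx m n (Z : 'M[int]_(m, n)) : 'M[rat]_(m, n) := map_mx intr Z.
Definition crat m n (T : 'M[rat]_(m, n)) : 'M[C]_(m, n) := cmx (ratmx R T).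
Definition czmx m n (Z : 'M[int]_(m, n)) : 'M[C]_(m, n) := crat (zmx Z).

Lemma zmxM m n p (Y : 'M_(m, n)) (Z : 'M_(n, p)) : zmx (Y *m Z) = zmx Y *m zmx Z.
Proof. exact: map_mxM. Qed.

Lemma cratM m n p (S : 'M_(m, n)) (T : 'M_(n, p)) : crat (S *m T) = crat S *m crat T.
Proof. by rewrite /crat ratmxM cmxM. Qed.

Lemma czmxM m n p (Y : 'M_(m, n)) (Z : 'M_(n, p)) : czmx (Y *m Z) = czmx Y *m czmx Z.
Proof. by rewrite /czmx zmxM cratM. Qed.

Lemma czmxE m n (Z : 'M[int]_(m, n)) : czmx Z = map_mx intr Z.
Proof. by apply/matrixP => i j; rewrite !mxE ratr_int rmorph_int. Qed.

Lemma ratmx_zmxE m n (Z : 'M[int]_(m, n)) : ratmx R (zmx Z) = map_mx intr Z.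
Proof. by apply/matrixP => i j; rewrite !mxE ratr_int. Qed.

(** [B] is a period matrix: its rows form a basis of the lattice, and [J] is multiplication by i in
    that basis. *)
Definition model g (A : abelianVariety R g) n (J : 'M[R]_n) (B : 'M[C]_(n, g)) :=
  [/\ rbasis B, cmx J *m B = ii *: B
    & forall v, lattice A v <-> exists z : 'rV[int]_n, v = czmx z *m B].

Definition modelled g (A : abelianVariety R g) n (J : 'M[R]_n) :=
  exists B, model A J B.

Lemma model_row g (A : abelianVariety R g) n (J : 'M[R]_n) B i :
  model A J B -> lattice A (row i B).
Proof.
move=> [_ _ lA]; apply/lA; exists (delta_mx 0 i).
by rewrite czmxE map_delta_mx -rowE.
Qed.

Lemma lattice_basis g (A : abelianVariety R g) : exists n (B : 'M[C]_(n, g)),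
  rbasis B /\ forall v, lattice A v <-> exists z : 'rV[int]_n, v = czmx z *m B.
Proof.
have [I [b [bP ->]]] := latticeP A.
pose B : 'M[C]_(#|I|, g) := \matrix_i b (enum_val i).
have sumE (x : I -> C) : (\row_j x (enum_val j)) *m B = \sum_i x i *: b i.
  rewrite mulmx_sum_row (reindex (@enum_val I I)) /=; last exact/onW_bij/enum_val_bij.
  by apply: eq_bigr => i _; rewrite mxE rowK.
exists #|I|, B; split=> v.
  have [x [xE xU]] := bP v; exists (\row_j x (enum_val j)); split.
    rewrite {1}xE -(sumE (fun i => real_complex R (x i))); congr (_ *m _).
    by apply/rowP => j; rewrite !mxE.
  move=> y yE; have -> : x = [ffun i => y 0 (enum_rank i)].
    apply: xU; rewrite yE -(sumE (fun i => real_complex R ([ffun i => y 0 (enum_rank i)] i))).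
    by congr (_ *m _); apply/rowP => j; rewrite !mxE ffunE enum_valK.
  by apply/rowP => j; rewrite !mxE ffunE enum_valK.
split=> [[z ->]|[z ->]].
  exists (\row_j z (enum_val j)).
  rewrite (_ : czmx _ = \row_j (z (enum_val j))%:~R); last first.
    by apply/rowP => j; rewrite czmxE !mxE.
  by rewrite (sumE (fun i => (z i)%:~R)); apply: eq_bigr => i _; rewrite scaler_int.
exists (fun i => z 0 (enum_rank i)).
rewrite (_ : czmx z = \row_j (z 0 (enum_rank (enum_val j)))%:~R); last first.
  by apply/rowP => j; rewrite czmxE !mxE enum_valK.
by rewrite (sumE (fun i => (z 0 (enum_rank i))%:~R)); apply: eq_bigr => i _; rewrite scaler_int.
Qed.

Lemma immx_sumz m n (I : finType) (F : I -> 'M[C]_(m, n)) (z : I -> int) :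
  immx (\sum_i F i *~ z i) = \sum_i (z i)%:~R *: immx (F i).
Proof.
apply/matrixP => a b; rewrite mxE !summxE raddf_sum; apply: eq_bigr => i _.
rewrite !mxE -[F i *~ z i]scaler_int mxE; case: (F i a b) => x y /=.
have -> : (z i)%:~R = real_complex R (z i)%:~R by rewrite rmorph_int.
by rewrite /=; ring.
Qed.

Lemma ctr_sumz m n (I : finType) (F : I -> 'M[C]_(m, n)) (z : I -> int) :
  ctr (\sum_i F i *~ z i) = \sum_i ctr (F i) *~ z i.
Proof.
apply/matrixP => a b; rewrite 2!mxE !summxE rmorph_sum; apply: eq_bigr => i _.
rewrite -[F i *~ z i]scaler_int -[_ *~ z i in RHS]scaler_int !mxE.
by rewrite rmorphM rmorph_int.
Qed.

Lemma gram_sumz n g (B : 'M[C]_(n, g)) (I : finType) (F : I -> 'M[C]_g) (z : I -> int) :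
  gram B (\sum_i F i *~ z i) = \sum_i gram B (F i) *~ z i.
Proof.
rewrite /gram mulmx_sumr mulmx_suml; apply: eq_bigr => i _.
by rewrite -[F i *~ z i]scaler_int -scalemxAr -scalemxAl scaler_int.
Qed.

Lemma ratmx_sum m n (I : finType) (T : I -> 'M[rat]_(m, n)) (c : I -> rat) :
  ratmx R (\sum_i c i *: T i) = \sum_i ratr (c i) *: ratmx R (T i).
Proof. by rewrite /ratmx raddf_sum; apply: eq_bigr => i _; apply: map_mxZ. Qed.

(** Stated for a bare set [L] because [realize] uses it to construct the polarization of a lattice
    that is not yet an abelian variety. *)
Lemma gram_NS_of n g (B : 'M[C]_(n, g)) (J : 'M[R]_n) (L : set 'rV[C]_g) :
  rbasis B -> cmx J *m B = ii *: B ->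
  (forall v, L v -> exists z : 'rV[int]_n, v = czmx z *m B) ->
  forall H (Z : 'M[int]_n), ctr H = H -> immx (gram B H) = ratmx R (zmx Z) -> NS_of L H.
Proof.
move=> bB JB lL H Z hH ZE; split; first exact/hermsymP.
move=> _ _ /lL [z ->] /lL [w ->].
rewrite gram_form.
have [-> _ _] := gram_relations bB JB hH.
rewrite mulmxDr mulmxDl -scalemxAr -scalemxAl /czmx /crat -!cmxM ZE.
rewrite -ratmxT -!ratmxM.
have -> (a b : 'M[R]_1) : complex.Im ((cmx a + ii *: cmx b) 0 0) = b 0 0.
  by rewrite !mxE /=; ring.
rewrite (_ : (zmx w)^T = zmx w^T) -?zmxM; last by rewrite /zmx map_trmx.
by rewrite ratmx_zmxE mxE; apply: intr_int.
Qed.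

Section NeronSeveri.
Variables (g : nat) (A : abelianVariety R g) (n : nat) (J : 'M[R]_n) (B : 'M[C]_(n, g)).
Hypothesis mA : model A J B.
Let bB : rbasis B. Proof. by case: mA. Qed.
Let JB : cmx J *m B = ii *: B. Proof. by case: mA. Qed.

Lemma NS_gram H : NS A H ->
  ctr H = H /\ exists Z : 'M[int]_n, immx (gram B H) = ratmx R (zmx Z) /\ ns_form J (zmx Z).
Proof.
move=> [/hermsymP hH iH]; split=> //.
have /choice [z zP] : forall ij : 'I_n * 'I_n, exists z : int, immx (gram B H) ij.1 ij.2 = z%:~R.
  move=> [i j] /=; have := iH _ _ (model_row i mA) (model_row j mA).
  have rE k : row k B = cmx (delta_mx 0 k) *m B by rewrite /cmx map_delta_mx -rowE.
  rewrite !rE gram_form trmx_delta /cmx !map_delta_mx -rowE -colE !mxE.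
  by move=> /intrP.
pose Z := \matrix_(i, j) z (i, j).
have ZE : immx (gram B H) = ratmx R (zmx Z).
  by rewrite ratmx_zmxE; apply/matrixP => i j; rewrite (zP (i, j)) !mxE.
exists Z; split=> //; have [_ QT QJ] := gram_relations bB JB hH.
rewrite ZE in QT QJ; split=> //.
by apply: (@ratmx_inj R); rewrite ratmxT QT ratmxN.
Qed.

Let gram_NS H (Z : 'M[int]_n) : ctr H = H -> immx (gram B H) = ratmx R (zmx Z) -> NS A H.
Proof. by case: mA => _ _ lA; apply: (gram_NS_of bB JB) => v /lA. Qed.

Lemma ratmx_int_form (Z : 'M[int]_n) : ns_form J (zmx Z) ->
  (ratmx R (zmx Z))^T = - ratmx R (zmx Z) /\
  J *m ratmx R (zmx Z) *m J^T = ratmx R (zmx Z).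
Proof. by move=> [aZ bZ]; rewrite -ratmxT aZ ratmxN. Qed.

Lemma polarized_model : polarized J.
Proof.
have cJ := cplx_str_model bB JB; split=> //.
have [H [nH pH]] := polarizable A; have [hH [Z [ZE hZ]]] := NS_gram nH.
exists (zmx Z); split=> // x x0; rewrite -ZE -ltcR -(gram_pos bB JB) //.
apply: pH; apply: contra_neq x0 => xB; apply: (rbasis_inj bB).
by rewrite /= xB cmx0 mul0mx.
Qed.

Lemma picard_number_model : picard_number A = rho J.
Proof.
apply: ZrankP; split.
  (* Lower bound: each vector of a rational basis is scaled by a common denominator, so that it
     becomes the imaginary part of an integral Hermitian form. *)
  pose e (i : 'I_(rho J)) : 'M[rat]_n := (vbasis (vspace_of (ns_form J)))`_i.
  have eP i : ns_form J (e i).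
    by apply/(vspace_ofP (subspace_ns_form J)); apply: vbasis_mem; rewrite mem_nth ?size_tuple.
  have /choice [d dP] : forall i, exists dH : nat * 'M[C]_g, [/\ (0 < dH.1)%N, NS A dH.2
      & immx (gram B dH.2) = ratmx R (dH.1%:R *: e i)].
    move=> i; have [D [Z [D0 DZ]]] := clear_denominators (e i).
    have hZ : ns_form J (zmx Z).
      by rewrite /zmx -DZ; apply: subspace_predZ => //; apply: subspace_ns_form.
    have [QT QJ] := ratmx_int_form hZ.
    have [H [hH GE]] := gram_ex bB JB QT QJ.
    have ZE : immx (gram B H) = ratmx R (zmx Z) by rewrite GE immxE.
    by exists (D, H); split=> //=; [apply: gram_NS ZE | rewrite ZE DZ].
  exists (fun i => (d i).2); split; first by move=> i; case: (dP i).
  move=> z z0 i.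
  have fE : free (vbasis (vspace_of (ns_form J))) by apply: basis_free (vbasisP _).
  have := (freeP fE) (fun i => (z i)%:~R * (d i).1%:R) _ i.
  have [d0 _ _] := dP i; move=> h; have /eqP : (z i)%:~R * (d i).1%:R = 0 :> rat.
    apply: h; apply: (@ratmx_inj R).
    transitivity (immx (gram B (\sum_i (d i).2 *~ z i))); last first.
      by rewrite z0 /gram mulmx0 mul0mx ratmx0; apply/matrixP => a b; rewrite !mxE.
    rewrite gram_sumz immx_sumz ratmx_sum; apply: eq_bigr => k _.
    have [_ _ ->] := dP k.
    by rewrite ratmxZ scalerA rmorphM /= ratr_int.
  rewrite mulf_eq0 intr_eq0 pnatr_eq0 -[X in _ || X]negbK -lt0n d0 orbF.
  by move/eqP.
(* Upper bound: too many matrices cannot be free over the rationals. Yet a relation between them,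
   cleared of denominators, is an integral relation between the forms, since the imaginary part
   determines the form; [Zfree] makes it trivial. *)
move=> [x [xNS fx]].
have /choice [Z ZP] : forall i, exists Z : 'M[int]_n,
    immx (gram B (x i)) = ratmx R (zmx Z) /\ ns_form J (zmx Z).
  by move=> i; have [_] := NS_gram (xNS i).
pose X := [tuple zmx (Z i) | i < (rho J).+1].
have nf : ~~ free X.
  apply/negP => fX; have : (\dim <<X>> <= rho J)%N.
    apply: dimvS; apply/span_subvP => _ /mapP [i _ ->].
    by apply/(vspace_ofP (subspace_ns_form J)); case: (ZP i).
  by move: fX; rewrite /free size_tuple => /eqP ->; rewrite ltnn.
apply: (negP nf); apply/freeP => k kX.
have [D [zk [D0 zkE]]] := clear_denominators (\row_i k i).
have kE i : D%:R * k i = (zk 0 i)%:~R by move/rowP: zkE => /(_ i); rewrite !mxE.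
have zk0 i : zk 0 i = 0.
  apply: (fx (fun i => zk 0 i)); apply: (gram_eq0 bB).
  pose Q := \sum_i D%:R * k i *: zmx (Z i).
  have Q0 : Q = 0.
    rewrite -[RHS](scaler0 _ (D%:R : rat)) -[in RHS]kX scaler_sumr; apply: eq_bigr => j _.
    by rewrite scalerA -tnth_nth tnth_mktuple.
  have imE : immx (gram B (\sum_i x i *~ zk 0 i)) = 0.
    rewrite -(ratmx0 R n n) -Q0 gram_sumz immx_sumz ratmx_sum; apply: eq_bigr => j _.
    by rewrite kE ratr_int; case: (ZP j) => ->.
  have hH : ctr (\sum_i x i *~ zk 0 i) = \sum_i x i *~ zk 0 i.
    rewrite ctr_sumz; apply: eq_bigr => j _.
    by have [-> _] := NS_gram (xNS j).
  have [-> _ _] := gram_relations bB JB hH.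
  by rewrite imE mulmx0 !cmx0 scaler0 addr0.
move=> i; have /eqP := kE i; rewrite zk0 mulf_eq0 pnatr_eq0.
by move: D0; rewrite lt0n => /negPf -> /eqP.
Qed.

End NeronSeveri.
End Varieties.

(** * From complex structures to abelian varieties and back *)

Section Dictionary.
Variable R : realType.
Local Notation C := (R[i])%C.
Local Notation ii := (Complex 0 1 : C).

Lemma czmx_sum n g (B : 'M[C]_(n, g)) (z : 'rV[int]_n) :
  czmx R z *m B = \sum_i row i B *~ z 0 i.
Proof.
rewrite mulmx_sum_row; apply: eq_bigr => i _.
by rewrite czmxE mxE scaler_int.
Qed.

Lemma realize n g (J : 'M[R]_n) (B : 'M[C]_(n, g)) :
  polarized J -> rbasis B -> cmx J *m B = ii *: B ->
  exists A : abelianVariety R g, model A J B.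
Proof.
move=> [_ [E hE]] bB JB.
pose L := [set v | exists z : 'I_n -> int, v = \sum_i row i B *~ z i]%classic.
have LP v : L v <-> exists z : 'rV[int]_n, v = czmx R z *m B.
  split=> [[z ->]|[z ->]]; last by exists (fun i => z 0 i); rewrite czmx_sum.
  by exists (\row_i z i); rewrite czmx_sum; apply: eq_bigr => i _; rewrite mxE.
have xE (x : {ffun 'I_n -> R}) :
    \sum_i real_complex R (x i) *: row i B = cmx (\row_i x i) *m B.
  by rewrite mulmx_sum_row; apply: eq_bigr => i _; rewrite !mxE.
have latL : is_lattice L.
  exists 'I_n, (fun i => row i B); split=> // v.
  have [x [vE xU]] := bB v; exists [ffun i => x 0 i]; split.
    by rewrite xE vE; congr (cmx _ *m _); apply/rowP => i; rewrite !(mxE, ffunE).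
  by move=> y; rewrite xE => /xU ->; apply/ffunP => i; rewrite !(mxE, ffunE).
have polL : exists H, NS_of L H /\ positive_definite H.
  have [D [Z [D0 DZ]]] := clear_denominators E.
  have [nE pE] := hE.
  have hZ : ns_form J (zmx Z).
    by rewrite /zmx -DZ; apply: subspace_predZ => //; apply: subspace_ns_form.
  have [QT QJ] := ratmx_int_form hZ.
  have [H [hH GE]] := gram_ex bB JB QT QJ.
  have ZE : immx (gram B H) = ratmx R (zmx Z) by rewrite GE immxE.
  exists H; split; first by apply: (gram_NS_of bB JB) ZE => // v /LP.
  move=> u u0; have [x [uE _]] := bB u.
  rewrite uE (gram_pos bB JB) // ltcR ZE /zmx -DZ ratmxZ.
  rewrite -scalemxAr -scalemxAl mxE mulr_gt0 ?ltr0q ?ltr0n //.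
  by apply: pE; apply: contra_neq u0 => x0; rewrite uE x0 cmx0 mul0mx.
by exists (AbelianVariety latL polL).
Qed.

Lemma realize_curve (J : 'M[R]_2) : polarized J ->
  exists E : ellipticCurve R, modelled E J.
Proof.
move=> pJ; have [cJ _] := pJ.
pose a := J 0 0; pose b := J 0 1; pose c := J 1 0; pose d := J 1 1.
have o1 : lift ord0 ord0 = 1 :> 'I_2 by apply: val_inj.
have i2 (i : 'I_2) : i = 0 \/ i = 1 by case: i => [[|[|]]] // ?; [left|right]; apply: val_inj.
have e00 : a * a + b * c = -1.
  by move/matrixP: cJ => /(_ 0 0); rewrite !mxE !big_ord_recl big_ord0 addr0 o1 /=.
have e01 : a * b + b * d = 0.
  by move/matrixP: cJ => /(_ 0 1); rewrite !mxE !big_ord_recl big_ord0 addr0 o1 /= oppr0.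
have b0 : b != 0.
  apply/eqP => b0; move: e00; rewrite b0 mul0r addr0 => e.
  by have := sqr_ge0 a; rewrite expr2 e ler0N1.
have ad : d = - a by apply: (mulfI b0); apply/eqP; rewrite -subr_eq0 -e01; apply/eqP; ring.
(* The column (b, i - a) is the eigenvector of [J] for the eigenvalue i with first entry b; it is a
   period matrix because b is nonzero. *)
pose B : 'M[C]_(2, 1) := \matrix_(i, j) if i == 0 then Complex b 0 else Complex (- a) 1.
have xB (x : 'rV[R]_2) : cmx x *m B = (Complex (x 0 0 * b - x 0 1 * a) (x 0 1))%:M.
  apply/matrixP => i j; rewrite !ord1 !mxE !big_ord_recl big_ord0 addr0 o1 !mxE /=.
  by apply/eqP; rewrite eq_complex /=; apply/andP; split; apply/eqP; ring.
have bB : rbasis B.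
  move=> v; rewrite [v]mx11_scalar; case: (v 0 0) => p q.
  exists (\row_j if j == 0 then (p + q * a) / b else q); split.
    rewrite xB !mxE /= divfK //; congr (Complex _ _)%:M; ring.
  move=> y; rewrite xB => /matrixP/(_ 0 0); rewrite !mxE /= => -[pE qE].
  apply/rowP => j; rewrite mxE; case: (i2 j) => -> //=.
  by rewrite pE qE subrK mulfK.
have JB : cmx J *m B = ii *: B.
  apply/row_matrixP => i; rewrite row_mul /cmx -map_row xB linearZ /=.
  apply/matrixP => k l; rewrite !ord1 !mxE; case: (i2 i) => -> /=.
    by apply/eqP; rewrite eq_complex /=; apply/andP; split; apply/eqP; rewrite /a /b; ring.
  rewrite -/c -/d ad; apply/eqP; rewrite eq_complex /=; apply/andP; split; apply/eqP; last ring.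
  transitivity (a * a + b * c); first by ring.
  by rewrite e00; ring.
by have [E mE] := realize pJ bB JB; exists E, B.
Qed.

Lemma model_point : modelled (Defs.point R) (0 : 'M[R]_0).
Proof.
exists 0; split; first 1 last.
- by rewrite flatmx0 [RHS]flatmx0.
- by move=> v; split=> // _; exists 0; rewrite [LHS]thinmx0 [RHS]thinmx0.
move=> v; exists 0; split; first by rewrite [LHS]thinmx0 [RHS]thinmx0.
by move=> x _; rewrite [RHS]thinmx0.
Qed.

Lemma modelled_prod g h (A : abelianVariety R g) (B : abelianVariety R h)
    n m (J : 'M[R]_n) (K : 'M[R]_m) :
  modelled A J -> modelled B K -> modelled (prodAV A B) (dsum J K).
Proof.
move=> [b [bb Jb lA]] [c [bc Kc lB]]; exists (block_mx b 0 0 c).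
have rE (x : 'rV[C]_n) (y : 'rV[C]_m) :
    row_mx x y *m block_mx b 0 0 c = row_mx (x *m b) (y *m c).
  by rewrite mul_row_block !mulmx0 addr0 add0r.
have cE (x : 'rV[R]_n) (y : 'rV[R]_m) : cmx (row_mx x y) = row_mx (cmx x) (cmx y).
  exact: map_row_mx.
split.
- move=> v; have [x [xE xU]] := bb (lsubmx v); have [y [yE yU]] := bc (rsubmx v).
  exists (row_mx x y); split; first by rewrite cE rE -xE -yE hsubmxK.
  move=> w; rewrite -[w]hsubmxK cE rE -{1}[v]hsubmxK => /eq_row_mx [/xU -> /yU ->].
  by [].
- rewrite /cmx /dsum map_block_mx !map_mx0 mulmx_block !mulmx0 !mul0mx !(addr0, add0r).
  by rewrite -!/(cmx _) Jb Kc scale_block_mx !scaler0.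
move=> v; split.
  move=> [/lA [x xE] /lB [y yE]]; exists (row_mx x y).
  by rewrite /czmx /crat /ratmx /zmx /cmx !map_row_mx rE -[v]hsubmxK xE yE.
move=> [z]; rewrite -[z]hsubmxK /czmx /crat /ratmx /zmx /cmx !map_row_mx rE => ->.
rewrite /lattice /= /prod_lattice /= row_mxKl row_mxKr.
by split; [apply/lA; exists (lsubmx z) | apply/lB; exists (rsubmx z)].
Qed.

Lemma modelled_pow g (A : abelianVariety R g) n (J : 'M[R]_n) k :
  modelled A J -> modelled (powAV A k) (pw J k).
Proof.
move=> mA; elim: k => [|k IH] /=; first exact: model_point.
exact: modelled_prod.
Qed.

Lemma exists_model g (A : abelianVariety R g) :
  exists J : 'M[R]_(g * 2), polarized J /\ modelled A J.
Proof.
have [n [B [bB lA]]] := lattice_basis A.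
have nE := rbasis_size bB; subst n.
have [J JB] := rbasis_cplx bB.
have mA : model A J B by [].
by exists J; split; [exact: polarized_model mA | exists B].
Qed.

End Dictionary.

(** * Homomorphisms and isogenies *)

Section Homomorphisms.
Variable R : realType.
Local Notation C := (R[i])%C.
Local Notation ii := (Complex 0 1 : C).
Variables (g h : nat) (A : abelianVariety R g) (A' : abelianVariety R h).
Variables (n n' : nat) (J : 'M[R]_n) (J' : 'M[R]_n') (B : 'M[C]_(n, g)) (B' : 'M[C]_(n', h)).
Hypotheses (mA : model A J B) (mA' : model A' J' B').
Let bB : rbasis B. Proof. by case: mA. Qed.
Let JB : cmx J *m B = ii *: B. Proof. by case: mA. Qed.
Let bB' : rbasis B'. Proof. by case: mA'. Qed.
Let JB' : cmx J' *m B' = ii *: B'. Proof. by case: mA'. Qed.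

Lemma hom_matrix M : is_hom A A' M ->
  exists Z : 'M[int]_(n, n'), B *m M = czmx R Z *m B' /\ hodge_hom J J' (zmx Z).
Proof.
have [_ _ lA'] := mA' => hM.
have /choice [z zP] : forall i, exists z : 'rV[int]_n', row i B *m M = czmx R z *m B'.
  by move=> i; apply/lA'/hM/(model_row i mA).
pose Z := \matrix_i z i; have ZE : B *m M = czmx R Z *m B'.
  apply/row_matrixP => i; rewrite !row_mul zP; congr (_ *m _).
  by rewrite !czmxE -map_row rowK.
exists Z; split=> //; apply: (rbasis_inj bB'); rewrite /= !cmxM -!mulmxA JB'.
by rewrite -scalemxAr -[cmx _ *m B']ZE mulmxA JB -scalemxAl.
Qed.

Lemma matrix_hom Z : hodge_hom J J' (zmx Z) ->
  exists M, is_hom A A' M /\ B *m M = czmx R Z *m B'.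
Proof.
have [_ _ lA] := mA; have [_ _ lA'] := mA' => hZ.
have [M MB] := model_hom bB JB JB' hZ.
exists M; split=> // v /lA [z ->]; apply/lA'; exists (z *m Z).
by rewrite czmxM -!mulmxA MB.
Qed.

(** If a nonzero rational v were killed by the matrix of [M], its rational multiples would give
    infinitely many points of the kernel, more than [s] can represent. *)
Lemma isogeny_isog M : g = h -> is_isogeny A A' M -> isog J J'.
Proof.
have [_ _ lA] := mA; have [_ _ lA'] := mA' => gh [hM _ [s sP]].
have [Z [ZE hZ]] := hom_matrix hM.
apply: isog_of_free hZ; first by rewrite (rbasis_size bB) (rbasis_size bB') gh.
apply: inj_row_free => v vZ; apply/eqP/negPn/negP => v0.
have [i vi] : exists i, v 0 i != 0.
  by apply: contrapT => e; case/eqP: v0; apply/rowP => i; rewrite mxE;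
    apply/eqP/negPn/negP => vi; apply: e; exists i.
(* the multiples of [v / (v_i (N + 1))] by [0, ..., N] are pairwise
   incongruent modulo the lattice *)
pose N := size s.
pose u (k : nat) : 'rV[rat]_n := (k%:R / (N.+1%:R * v 0 i)) *: v.
have uP (k : 'I_N.+1) : exists j : 'I_N, lattice A (crat R (u k) *m B - nth 0 s j).
  have /sP [w ws wA] : lattice A' (crat R (u k) *m B *m M).
    apply/lA'; exists 0; rewrite -mulmxA ZE mulmxA /czmx -!cratM /u -scalemxAl vZ scaler0.
    by congr (crat R _ *m _); apply/rowP => j; rewrite !mxE.
  have ws' : (index w s < N)%N by rewrite index_mem.
  by exists (Ordinal ws'); rewrite /= nth_index.
have [j jP] := choice uP.
have [k [l kl jkl]] : exists k, exists2 l, k != l & j k = j l.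
  apply: contrapT => e; have /leq_card : injective j.
    move=> k l jkl; apply/eqP/negPn/negP => kl; apply: e.
    by exists k, l.
  by rewrite !card_ord ltnn.
have /lA [z zE] : lattice A (crat R (u k - u l) *m B).
  have -> : crat R (u k - u l) *m B = (crat R (u k) *m B - nth 0 s (j k)) -
      (crat R (u l) *m B - nth 0 s (j l)).
    rewrite jkl opprB addrA subrK -mulmxBl; congr (_ *m _).
    by rewrite /crat ratmxD ratmxN cmxD cmxN.
  exact: latticeB.
have /ratmx_inj uz : ratmx R (u k - u l) = ratmx R (zmx z) by apply: (rbasis_inj bB).
(* The i-th coordinate of [u k - u l] is (k - l) / (N + 1). It is an integer, while k and l lie
   between 0 and N, so k = l. *)
have : (k%:R - l%:R) = (z 0 i)%:~R * N.+1%:R :> rat.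
  move/rowP: uz => /(_ i); rewrite !mxE => <-.
  have : N.+1%:R != 0 :> rat by rewrite pnatr_eq0.
  by move: (N.+1%:R) => c c0; field; rewrite vi c0.
rewrite !pmulrn -intrM -intrB => /intr_inj e.
have kN := ltn_ord k; have lN := ltn_ord l.
move: e; move: (z 0 i) => zi e; move/eqP: kl; apply; apply: val_inj => /=.
have : zi = 0 by clear -e kN lN; nia.
by move=> z0; rewrite z0 in e; clear -e; lia.
Qed.

Lemma isog_isogenous : isog J J' -> isogenous A A'.
Proof.
have [_ _ lA] := mA; have [_ _ lA'] := mA' => -[T0 [fT0 uT0 hT0]].
have [D0 [Z [D00 DZ]]] := clear_denominators T0.
have D0n : D0%:R != 0 :> rat by rewrite pnatr_eq0 -lt0n.
have ZT : (zmx Z :=: T0)%MS by rewrite /zmx -DZ; apply: eqmx_scale.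
have fT : row_free (zmx Z) by rewrite /row_free ZT.
have uT : row_full (zmx Z) by rewrite /row_full ZT.
have hT : hodge_hom J J' (zmx Z).
  by rewrite /zmx -DZ; apply: subspace_predZ => //; apply: subspace_hodge_hom.
have [M [hM MB]] := matrix_hom hT.
pose S := pinvmx (zmx Z).
have ST : S *m zmx Z = 1%:M := mulVpmx uT.
have TS : zmx Z *m S = 1%:M := mulmxVp fT.
exists M; split=> //.
  move=> w; have [x [-> _]] := bB' w.
  exists (cmx (x *m ratmx R S) *m B); rewrite -mulmxA MB mulmxA /czmx -cmxM.
  rewrite -mulmxA -ratmxM ST ratmx1 mulmx1 subrr; exact: lattice0.
(* [D.+1] is a common denominator of the inverse matrix. Points of the kernel have coordinates in (1
   / D.+1) Z, so reducing the numerators modulo [D.+1] leaves finitely many representatives. *)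
have [[|D] [Y [//_ DY]]] := clear_denominators S.
exists [seq crat R (D.+1%:R^-1 *: \row_i (f i : nat)%:R) *m B | f : {ffun 'I_n -> 'I_D.+1}].
move=> v /lA' [z zE]; have [x [xE _]] := bB v.
have xT : x *m ratmx R (zmx Z) = ratmx R (zmx z).
  by apply: (rbasis_inj bB'); rewrite /= cmxM -mulmxA -[cmx _ *m B']MB mulmxA -xE zE.
have {xT} xz : x = ratmx R (zmx z *m S).
  by rewrite ratmxM -xT -mulmxA -ratmxM TS ratmx1 mulmx1.
have [y yE] : exists y, zmx z *m S = D.+1%:R^-1 *: zmx y.
  by exists (z *m Y); rewrite zmxM /zmx -DY -scalemxAr scalerA mulVf ?pnatr_eq0 // scale1r.
have rP i : (`|(y ord0 i %% D.+1)%Z| < D.+1)%N.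
  by rewrite -ltz_nat gez0_abs ?modz_ge0 // ltz_pmod.
pose f := [ffun i => Ordinal (rP i)].
exists (crat R (D.+1%:R^-1 *: \row_i (f i : nat)%:R) *m B).
  by apply/mapP; exists f; rewrite ?mem_enum.
apply/lA; exists (\row_i (y ord0 i %/ D.+1)%Z).
rewrite xE xz yE -mulmxBl -/(crat R _) -/(czmx R _); congr (_ *m _).
rewrite /czmx /crat -cmxN -cmxD -ratmxN -ratmxD -scalerBr; congr (cmx (ratmx R _)).
apply/rowP => i; rewrite !mxE ffunE /=.
have -> : `|(y ord0 i %% D.+1)%Z|%:R = (y ord0 i %% D.+1)%Z%:~R :> rat.
  by rewrite pmulrn gez0_abs ?modz_ge0.
rewrite {1}(divz_eq (y ord0 i) D.+1).
by rewrite intrD intrM addrK mulrC mulfK // pnatr_eq0.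
Qed.

End Homomorphisms.

(** * Translation of the geometric notions into matrices *)

Section Transfer.
Variable R : realType.
Implicit Types (g h n m : nat).

Lemma isogenousE g h (A : abelianVariety R g) (A' : abelianVariety R h) n n'
    (J : 'M[R]_n) (J' : 'M[R]_n') :
  g = h -> modelled A J -> modelled A' J' -> isogenous A A' <-> isog J J'.
Proof.
move=> gh [B mA] [B' mA']; split; last exact: isog_isogenous mA mA'.
by move=> [M /(isogeny_isog mA mA' gh)].
Qed.

Lemma picard_numberE g (A : abelianVariety R g) n (J : 'M[R]_n) :
  modelled A J -> picard_number A = rho J.
Proof. by move=> [B]; apply: picard_number_model. Qed.

(** An integral endomorphism is a rational one, and an integral multiple of a rational one is
    integral. Scalars correspond: a scalar with integral matrix is an integer, and a multiple of U
    by a positive integer is scalar only if U is. *)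
Lemma has_CME (E : ellipticCurve R) (J : 'M[R]_2) : modelled E J -> has_CM E <-> cm J.
Proof.
move=> [B mE]; have [bB JB lE] := mE.
have [X XB] := rbasis_full bB; have uB : row_full B by apply/row_fullP; exists (cmx X).
split.
  move=> [M [hM nM]]; have [Z [ZE hZ]] := hom_matrix mE mE hM.
  exists (zmx Z); split=> // a Za; apply: (nM (Z 0 0)).
  apply: (row_full_inj uB); rewrite ZE mul_mx_scalar /czmx Za.
  have -> : a = (Z 0 0)%:~R by move/matrixP: Za => /(_ 0 0); rewrite !mxE eqxx mulr1n.
  rewrite /crat /ratmx /cmx !map_scalar_mx mul_scalar_mx; congr (_ *: _).
  by rewrite /= ratr_int rmorph_int.
move=> [U [hU nU]]; have [D [Z [D0 DZ]]] := clear_denominators U.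
have hZ : hodge_hom J J (zmx Z).
  by rewrite /zmx -DZ; apply: subspace_predZ => //; apply: subspace_hodge_hom.
have [M [hM MB]] := matrix_hom mE mE hZ.
exists M; split=> // k Mk; apply: (nU (k%:~R / D%:R)).
have D0' : D%:R != 0 :> rat by rewrite pnatr_eq0 -lt0n.
have : zmx Z = k%:~R%:M.
  apply: (@ratmx_inj R); apply: (rbasis_inj bB); rewrite /= -[LHS]MB Mk mul_mx_scalar.
  rewrite /ratmx /cmx !map_scalar_mx mul_scalar_mx; congr (_ *: _).
  by rewrite /= ratr_int rmorph_int.
rewrite /zmx -DZ => /(congr1 (fun T => D%:R^-1 *: T)).
by rewrite scalerA mulVf // scale1r => ->; rewrite scale_scalar_mx mulrC.
Qed.

Lemma exists_curve_model (E : ellipticCurve R) :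
  exists J : 'M[R]_2, polarized J /\ modelled E J.
Proof. exact (exists_model E). Qed.

(* The two cases of the theorem are [b = 1] and [b = 2]; [P] is the product
   [E1^a x E2^b] for the model used in the statement. *)
Lemma isogenous_two_powers g h a b (A : abelianVariety R g)
    (P : ellipticCurve R -> ellipticCurve R -> abelianVariety R h)
    n m (J : 'M[R]_n) (Q : 'M[R]_2 -> 'M[R]_2 -> 'M[R]_m) :
  g = h -> modelled A J ->
  (forall E1 E2 J1 J2, modelled E1 J1 -> modelled E2 J2 -> modelled (P E1 E2) (Q J1 J2)) ->
  (forall J1 J2, isog (Q J1 J2) (dsum (pw J1 a) (pw J2 b))) ->
  two_powers J a b <->
  exists E1 E2 : ellipticCurve R,
    [/\ has_CM E1, (1 < b)%N -> has_CM E2, ~ isogenous E1 E2 & isogenous A (P E1 E2)].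
Proof.
move=> gh mA mP iQ; split.
  move=> [J1 [J2 [[p1 p2 h0] iJ c1 c2]]].
  have [E1 m1] := realize_curve p1; have [E2 m2] := realize_curve p2.
  exists E1, E2; split.
  - exact/(has_CME m1).
  - by move=> /c2 ?; apply/(has_CME m2).
  - by move=> /(isogenousE erefl m1 m2); apply: hom_rank_eq0_isog h0.
  - apply/(isogenousE gh mA (mP _ _ _ _ m1 m2)).
    exact: isog_trans iJ (isog_sym (iQ _ _)).
move=> [E1 [E2 [c1 c2 n12 iA]]].
have [J1 [p1 m1]] := exists_curve_model E1; have [J2 [p2 m2]] := exists_curve_model E2.
exists J1, J2; split.
- split=> //; apply: hom_rank_elliptic => // i12; apply: n12.
  exact/(isogenousE erefl m1 m2).
- apply: isog_trans (iQ _ _).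
  exact/(isogenousE gh mA (mP _ _ _ _ m1 m2)).
- exact/(has_CME m1).
- by move=> /c2 ?; apply/(has_CME m2).
Qed.

End Transfer.

Theorem theorem4p2 (R : realType) (g : nat) (A : abelianVariety R g) :
  ((5 <= g)%N ->
     (picard_number A = ((g - 1) ^ 2 + 1)%N <->
      exists E1 E2 : ellipticCurve R,
        [/\ has_CM E1, ~ isogenous E1 E2
          & isogenous A (prodAV (powAV E1 (g - 1)) E2)]))
  /\
  ((7 <= g)%N ->
     (picard_number A = ((g - 2) ^ 2 + 4)%N <->
      exists E1 E2 : ellipticCurve R,
        [/\ has_CM E1, has_CM E2, ~ isogenous E1 E2
          & isogenous A (prodAV (powAV E1 (g - 2)) (powAV E2 2))])).
Proof.
have [J [pJ mA]] := exists_model A.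
rewrite (picard_numberE mA); split=> hg.
  (* The product of the statement has this dimension by construction, so the comparison with g goes
     through an equality of numbers. *)
  have gE : g = ((g - 1) * 1 + 1)%N by lia.
  (* The second factor is the curve itself, whereas [two_powers] speaks of its first power;
     [isog_pw1] links the two. *)
  have tp := isogenous_two_powers gE mA (fun E1 E2 J1 J2 m1 m2 =>
    modelled_prod (modelled_pow (g - 1) m1) m2)
    (fun J1 J2 => isog_dsum (isog_refl (pw J1 (g - 1))) (isog_sym (isog_pw1 J2))).
  split=> [/(rho_second pJ erefl hg)/tp|] [E1 [E2]].
    by move=> [c1 _ n12 iA]; exists E1, E2.
  move=> [c1 n12 iA]; rewrite (rho_two_powers (a := g - 1) (b := 1)) //.
  by apply/tp; exists E1, E2.
have gE : g = ((g - 2) * 1 + 2 * 1)%N by lia.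
have tp := isogenous_two_powers gE mA (fun E1 E2 J1 J2 m1 m2 =>
  modelled_prod (modelled_pow (g - 2) m1) (modelled_pow 2 m2))
  (fun J1 J2 => isog_refl (dsum (pw J1 (g - 2)) (pw J2 2))).
split=> [/(rho_third pJ erefl hg)/tp|] [E1 [E2]].
  by move=> [c1 c2 n12 iA]; exists E1, E2; split=> //; apply: c2.
move=> [c1 c2 n12 iA]; rewrite (rho_two_powers (a := g - 2) (b := 2)) //.
by apply/tp; exists E1, E2.
Qed.
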